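(* Let $G=(V,E,\nu,\mu)$ be a weighted graph such that $M:=\sup_{x\in V}\frac{\deg_x}{\nu_x}<\infty$. Suppose that $G$ has a positive essential spectral gap, i.e. $\inf\sigma_{\mathrm{ess}}(\Delta)>0$, and that $0\in\sigma(\Delta)$. Then $\nu(V):=\sum_{x\in V}\nu_x<\infty$, and for any $p\in(1,\infty)$, $$\||Df|\|_{\ell^p(E,\mu)}\approx\|f-\overline{f}\|_{\ell^p(V,\nu)}\approx\|\Delta^{1/2}f\|_{\ell^p(V,\nu)},\quad\forall f\in\mathcal{C}_0(V),$$ where $\overline{f}=\frac1{\nu(V)}\sum_{x\in V}f(x)\nu_x$.
   Context: A weighted graph $G=(V,E,\nu,\mu)$ consists of a connected, locally finite, undirected graph $(V,E)$ (each vertex has finitely many neighbors; $x\sim y$ means $\{x,y\}\in E$), vertex weights $\nu:V\to(0,\infty)$, $x\mapsto\nu_x$, and symmetric edge weights $\mu:E\to(0,\infty)$, $\{x,y\}\mapsto\mu_{xy}=\mu_{yx}$, extended to $V\times V$ by $\mu_{xy}=0$ if $\{x,y\}\notin E$. Put $\deg_x:=\sum_{y\in V}\mu_{xy}$. $\mathcal{C}_0(V)$ denotes the finitely supported real functions on $V$. The spaces $\ell^p(V,\nu)$ and $\ell^p(E,\mu)$ are the usual $\ell^p$ spaces over the discrete measure spaces $(V,\nu)$ and $(E,\mu)$. The Laplacian is $\Delta f(x)=\frac1{\nu_x}\sum_{y}\mu_{xy}(f(x)-f(y))$; when $\sup_x\deg_x/\nu_x<\infty$ it is a bounded nonnegative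 self-adjoint operator on $\ell^2(V,\nu)$, with $\ell^2(V,\nu)$-spectrum $\sigma(\Delta)$; $\Delta^{1/2}$ is its nonnegative square root. The essential spectrum $\sigma_{\mathrm{ess}}(\Delta)$ consists of those $\lambda$ that are either accumulation points of $\sigma(\Delta)$ or eigenvalues of infinite multiplicity. For $f:V\to\mathbb{R}$, $|Df|:E\to\mathbb{R}$ is defined by $|Df|(\{x,y\})=|f(x)-f(y)|$, so $\||Df|\|_{\ell^p(E,\mu)}^p=\sum_{\{x,y\}\in E}\mu_{xy}|f(x)-f(y)|^p$. For functionals $F,H\ge0$, $F(f)\approx H(f)$ for all $f$ in a class means there are constants $c,C>0$ independent of $f$ with $cH(f)\le F(f)\le CH(f)$ for all such $f$. *)

(* Defs.v *)
From HB Require Import structures.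
From mathcomp Require Import all_boot all_order all_algebra.
From mathcomp Require Import all_classical all_reals all_analysis.
Set Implicit Arguments.
Unset Strict Implicit.
Unset Printing Implicit Defensive.
Import Order.TTheory GRing.Theory Num.Theory.
Import numFieldNormedType.Exports.
Local Open Scope classical_set_scope.
Local Open Scope ring_scope.

(* The unordered pair {x, y} is the set [set x; y] : set V, so that edge data
   are symmetric in (x, y) by construction. Loops {x, x} = [set x] are not
   excluded: they contribute to deg only. *)
Record weighted_graph (R : realType) (V : choiceType) := WeightedGraph {
  edges : set (set V) ;
  edge_weight : set V -> R ;
  vertex_weight : V -> R ;
  edgesP : forall e, edges e -> exists x y, e = [set x; y] ;
  locally_finite : forall x, finite_set [set y | edges [set x; y]] ;
  graph_connected : forall x y, exists s : seq V,
    path (fun a b => `[< edges [set a; b] >]) x s /\ last x s = y ;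
  vertex_weight_gt0 : forall x, 0 < vertex_weight x ;
  edge_weight_gt0 : forall e, edges e -> 0 < edge_weight e ;
  edge_weight_out : forall e, ~ edges e -> edge_weight e = 0 }.

Section WeightedGraphDefs.
Context {R : realType} {V : choiceType} (G : weighted_graph R V).
Implicit Types (f g : V -> R) (T S : (V -> R) -> (V -> R)).

Local Notation nu := (vertex_weight G).
Local Notation mu := (fun x y : V => edge_weight G [set x; y]).

(* By local finiteness, the sums over y : V below have finite support. *)
Definition deg (x : V) : R := \sum_(y \in [set: V]) mu x y.

Definition laplacian f : V -> R :=
  fun x => (nu x)^-1 * \sum_(y \in [set: V]) mu x y * (f x - f y).

Definition nu_total : \bar R := (\esum_(x in [set: V]) (nu x)%:E)%E.

Definition finitely_supported f := finite_set [set x | f x != 0].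

Definition mean f : R :=
  (fine nu_total)^-1 * \sum_(x \in [set: V]) f x * nu x.

(* |Df| e is the common value of |f x - f y| over the x, y with e = {x, y};
   see abs_gradE. *)
Definition abs_grad f : set V -> R := fun e =>
  xget 0 [set r | exists x y, e = [set x; y] /\ r = `|f x - f y|].

(* The l^p norm over the discrete measure space (A, w); it is +oo outside
   l^p. *)
Definition lpnorm (I : choiceType) (A : set I) (w : I -> R) (p : R)
    (h : I -> R) : \bar R :=
  ((\esum_(i in A) (w i * `|h i| `^ p)%:E) `^ p^-1)%E.

Definition lpnormV (p : R) f : \bar R := lpnorm [set: V] nu p f.

Definition lpnormE (p : R) (h : set V -> R) : \bar R :=
  lpnorm (edges G) (edge_weight G) p h.

(* The Hilbert space l^2(V, nu) is the set of functions f with l2 f; operators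
   on it are represented by maps on all functions, whose values outside l2 are
   irrelevant. *)
Definition l2 f := (lpnormV 2 f < +oo)%E.

(* For f and g in l2 both sums are finite. *)
Definition l2dot f g : R :=
  let h x := f x * g x * nu x in
  fine (\esum_(x in [set: V]) ((h^\+)%R x)%:E)%E -
  fine (\esum_(x in [set: V]) ((h^\-)%R x)%:E)%E.

Definition l2_bounded_operator T :=
  (forall (a : R) f g, l2 f -> l2 g ->
     T (fun x => a * f x + g x) = (fun x => a * T f x + T g x)) /\
  (exists C : R, forall f, l2 f -> (lpnormV 2 (T f) <= C%:E * lpnormV 2 f)%E).

(* All operators considered are self-adjoint, so that their spectrum is real
   and real functions suffice to describe it. *)
Definition resolvent_set T : set R := [set lambda |
  exists S, l2_bounded_operator S /\
    forall f, l2 f ->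
      S (fun x => T f x - lambda * f x) = f /\
      (fun x => T (S f) x - lambda * S f x) = f].

Definition spectrum T : set R := ~` resolvent_set T.

Definition eigenvalue_infinite_multiplicity T (lambda : R) :=
  forall n : nat, exists e : 'I_n -> V -> R,
    (forall i, l2 (e i) /\ T (e i) = (fun x => lambda * e i x)) /\
    (forall c : 'I_n -> R,
       (forall x, \sum_(i < n) c i * e i x = 0) -> forall i, c i = 0).

Definition essential_spectrum T : set R := [set lambda |
  limit_point (spectrum T) lambda \/
  eigenvalue_infinite_multiplicity T lambda].

Definition is_nonneg_sqrt T S :=
  [/\ l2_bounded_operator S,
      forall f g, l2 f -> l2 g -> l2dot (S f) g = l2dot f (S g),
      forall f, l2 f -> 0 <= l2dot (S f) f &
      forall f, l2 f -> S (S f) = T f].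

(* A nonnegative bounded self-adjoint operator has exactly one nonnegative
   square root on l2, so the choice made by get is immaterial on l2. *)
Definition laplacian_sqrt : (V -> R) -> (V -> R) :=
  get [set S | is_nonneg_sqrt laplacian S].

Lemma abs_gradE f x y : abs_grad f [set x; y] = `|f x - f y|.
Proof.
rewrite /abs_grad; case: xgetP => [r _ [a [b [eab ->]]]|h]; last first.
  by case: (h `|f x - f y|); exists x, y.
have ha : [set x; y] a by rewrite eab; left.
have hb : [set x; y] b by rewrite eab; right.
have hx : [set a; b] x by rewrite -eab; left.
have hy : [set a; b] y by rewrite -eab; right.
case: ha hb hx hy => /= -> [] /= -> hx hy //.
- by case: hy => /= ->.
- exact: distrC.
- by case: hx => /= ->.
Qed.

End WeightedGraphDefs.

Definition comparable_on (R : realType) (X : Type) (K : X -> Prop)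
    (F H : X -> \bar R) :=
  exists c C : R, [/\ 0 < c, 0 < C &
    forall f, K f -> (c%:E * H f <= F f)%E /\ (F f <= C%:E * H f)%E].

(* Main.v *)
Require Import Defs.
From HB Require Import structures.
From mathcomp Require Import all_boot all_order all_algebra.
From mathcomp Require Import finmap.
From mathcomp Require Import all_classical all_reals all_analysis.
From mathcomp Require Import ring lra.
Set Implicit Arguments.
Unset Strict Implicit.
Unset Printing Implicit Defensive.
Import Order.TTheory GRing.Theory Num.Theory.
Import numFieldNormedType.Exports.
Local Open Scope classical_set_scope.
Local Open Scope ring_scope.

(** Let P = 1 - Delta / K with K twice the bound of deg / nu. This is the
averaging operator of a lazy walk that is reversible for nu; it contracts every
l^p, and on l^2 it satisfies 0 <= P <= 1. Write D = 1 - P.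

Spectral part. As 0 is not in the essential spectrum, an interval (0, e) is
free of spectrum, and this gives D^2 >= t D for some t > 0 ([spectral_gap]).
Under iteration of P the energy <D f, f> then decreases geometrically, so P^n f
converges to an element h of the kernel of D with |f - h|^2 <= C <D f, f>
([kernel_projection]). If the kernel were trivial, D would be invertible,
against 0 being in the spectrum. A function of the kernel has no energy, so it
is constant because the graph is connected: nonzero constants are square
summable, that is nu(V) is finite, and the inequality above is the l^2 Poincare
inequality.

From l^2 to l^p. Let f have finite support. By the intermediate value theorem
there is a constant m such that v = |f - m|^(p/2) sgn (f - m) has mean 0. The
Poincare inequality for v and the Stroock-Varopoulos inequality
([spow_sqr_diff]) show that, with g = f - m and phi = |g|^(p-1) sgn g,

    c |g|_p^p <= <D g, phi>          ([signed_power_poincare]).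

Writing the right-hand side as a sum over edges and applying Young's inequality
bounds |g|_p by the l^p norm of the gradient; and |f - mean f|_p is at most a
constant times |g|_p. The reverse bound is the triangle inequality on each edge
and the boundedness of deg / nu.

The square root. The iteration Q_(n+1) = (P + Q_n^2) / 2 consists of
polynomials in P with nonnegative coefficients of sum at most 1. It converges
to an operator Q with (1 - Q)^2 = 1 - P, so that the square root of Delta is
sqrt K (1 - Q), and Q contracts l^p because P does ([limit_convex], [Q_Lp]).
This gives the upper bound for the square root. For the lower bound, the
equation Q = (P + Q^2) / 2 and the contraction property of Q^2 yield
<(1 - Q) g, phi> >= <D g, phi> / 2 ([S_pairing_ge]); so the same inequality as
before, again with Young's inequality, bounds |g|_p by the norm of
(1 - Q) g = (1 - Q) f. No interpolation between l^p spaces is involved. *)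

(** * Inner product spaces *)

Lemma le0_cvg0 (R : realType) (a : R) (x : nat -> R) :
  (forall n, a <= x n) -> x n @[n --> \oo] --> 0 -> a <= 0.
Proof.
move=> ax x0; rewrite -(cvg_lim _ x0)//; apply: limr_ge; first exact/cvgP/x0.
exact: nearW.
Qed.

Record psd_form (R : realType) (H : lmodType R) (b : H -> H -> R) := PsdForm {
  formC : forall u v, b u v = b v u ;
  form_linear : forall a u v w, b (a *: u + v) w = a * b u w + b v w ;
  form_ge0 : forall u, 0 <= b u u }.

Section PsdForm.
Context {R : realType} {H : lmodType R} (b : H -> H -> R) (bP : psd_form b).

Lemma formDl u v w : b (u + v) w = b u w + b v w.
Proof. by rewrite -[u in LHS]scale1r (form_linear bP) mul1r. Qed.

Lemma form0l w : b 0 w = 0.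
Proof. by have := formDl 0 0 w; rewrite addr0; lra. Qed.

Lemma formZl a u w : b (a *: u) w = a * b u w.
Proof. by rewrite -[a *: u]addr0 (form_linear bP) form0l addr0. Qed.

Lemma formNl u w : b (- u) w = - b u w.
Proof. by rewrite -scaleN1r formZl mulN1r. Qed.

Lemma formDr u v w : b w (u + v) = b w u + b w v.
Proof. by rewrite formC // formDl !(formC bP w). Qed.

Lemma formZr a u w : b w (a *: u) = a * b w u.
Proof. by rewrite formC // formZl (formC bP w). Qed.

Lemma formNr u w : b w (- u) = - b w u.
Proof. by rewrite -scaleN1r formZr mulN1r. Qed.

Definition formE := (formDl, formDr, formNl, formNr, formZl, formZr).

Lemma form_CS u v : b u v ^+ 2 <= b u u * b v v.
Proof.
have [v0|v_neq0] := eqVneq (b v v) 0.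
  have [->|uv_neq0] := eqVneq (b u v) 0; first by rewrite v0 expr0n/= mulr0.
  (* The quadratic t |-> b (u - t v) (u - t v) is affine here; this t gives it
     the value - 1. *)
  have := form_ge0 bP (u - ((b u u + 1) / (2 * b u v)) *: v).
  rewrite !formE (formC bP v u) v0.
  have -> : b u u + - ((b u u + 1) / (2 * b u v) * b u v) +
    (- ((b u u + 1) / (2 * b u v) * b u v) -
     - ((b u u + 1) / (2 * b u v) * ((b u u + 1) / (2 * b u v) * 0))) = - 1.
    by field.
  by rewrite lerNr oppr0 ler10.
have v_gt0 : 0 < b v v by rewrite lt_neqAle eq_sym v_neq0 form_ge0.
have := form_ge0 bP (u - (b u v / b v v) *: v).
rewrite !formE (formC bP v u).
have -> : b u u + - (b u v / b v v * b u v) +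
    (- (b u v / b v v * b u v) - - (b u v / b v v * (b u v / b v v * b v v)))
  = (b u u * b v v - b u v ^+ 2) / b v v by field.
by rewrite pmulr_lge0 ?invr_gt0// subr_ge0.
Qed.

End PsdForm.

Record inner_product (R : realType) (H : lmodType R) (dot : H -> H -> R) :=
  InnerProduct {
    inner_psd :> psd_form dot ;
    inner_eq0 : forall u, dot u u = 0 -> u = 0 }.

Section InnerProduct.
Context {R : realType} {H : lmodType R} (dot : H -> H -> R).
Context (dotP : inner_product dot).
Implicit Types (u v w f g h : H) (T S P D : H -> H).

Definition nrm u := Num.sqrt (dot u u).

Let dotE := (formE dotP).
Let dotC := (formC dotP).

Lemma nrm_ge0 u : 0 <= nrm u. Proof. exact: sqrtr_ge0. Qed.

Lemma sqr_nrm u : nrm u ^+ 2 = dot u u.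
Proof. by rewrite sqr_sqrtr// (form_ge0 dotP). Qed.

Lemma dot_le_nrm u v : `|dot u v| <= nrm u * nrm v.
Proof.
rewrite -ler_sqr ?nnegrE ?mulr_ge0 ?nrm_ge0//.
by rewrite real_normK ?num_real// exprMn !sqr_nrm (form_CS dotP).
Qed.

Lemma nrmD u v : nrm (u + v) <= nrm u + nrm v.
Proof.
rewrite -ler_sqr ?nnegrE ?addr_ge0 ?nrm_ge0//.
rewrite sqr_nrm !dotE (dotC v u) sqrrD !sqr_nrm.
have := le_trans (ler_norm _) (dot_le_nrm u v); lra.
Qed.

Lemma nrmN u : nrm (- u) = nrm u.
Proof. by rewrite /nrm !dotE opprK. Qed.

Lemma nrmB u v : nrm (u - v) <= nrm u + nrm v.
Proof. by rewrite -(nrmN v) nrmD. Qed.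

Lemma nrmBC u v : nrm (u - v) = nrm (v - u).
Proof. by rewrite -opprB nrmN. Qed.

Lemma nrm_triangle v u w : nrm (u - w) <= nrm (u - v) + nrm (v - w).
Proof. by rewrite -[u in X in X <= _](subrK v) -addrA nrmD. Qed.

Lemma nrmZ a u : nrm (a *: u) = `|a| * nrm u.
Proof. by rewrite /nrm !dotE mulrA -expr2 sqrtrM ?sqr_ge0// sqrtr_sqr. Qed.

Lemma nrm0 : nrm 0 = 0.
Proof. by rewrite /nrm (form0l dotP) sqrtr0. Qed.

Lemma nrm_eq0 u : nrm u = 0 -> u = 0.
Proof.
by move=> u0; apply: (inner_eq0 dotP); rewrite -sqr_nrm u0 expr0n.
Qed.

Lemma nrm_le_cvg0 u (x : nat -> R) :
  (forall n, nrm u <= x n) -> x n @[n --> \oo] --> 0 -> u = 0.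
Proof.
move=> ux x0; apply: nrm_eq0; apply/eqP; rewrite eq_le nrm_ge0 andbT.
exact: le0_cvg0 ux x0.
Qed.

Definition symmetric_op T := forall u v, dot (T u) v = dot u (T v).

(** Identities between vectors are proved below by expanding inner products. *)
Lemma dot_ext u v : (forall w, dot u w = dot v w) -> u = v.
Proof.
move=> uv; apply/eqP; rewrite -subr_eq0; apply/eqP/(inner_eq0 dotP).
by rewrite (formDl dotP) (formNl dotP) uv subrr.
Qed.

(** Symmetry forces linearity, because the inner product separates vectors. *)
Lemma symmetric_linear T : symmetric_op T -> linear T.
Proof.
move=> Tsym a u v; apply: dot_ext => w.
by rewrite Tsym !dotE !Tsym.
Qed.

Lemma lin_add T : linear T -> forall u v, T (u + v) = T u + T v.
Proof. by move=> Tl u v; rewrite -[u in LHS]scale1r Tl scale1r. Qed.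

Lemma lin0 T : linear T -> T 0 = 0.
Proof.
move=> Tl; have := lin_add Tl 0 0; rewrite addr0 => /esym/eqP.
by rewrite -subr_eq0 addrK => /eqP.
Qed.

Lemma lin_scale T : linear T -> forall a u, T (a *: u) = a *: T u.
Proof. by move=> Tl a u; rewrite -[a *: u]addr0 Tl lin0// addr0. Qed.

Lemma lin_opp T : linear T -> forall u, T (- u) = - T u.
Proof. by move=> Tl u; rewrite -scaleN1r lin_scale// scaleN1r. Qed.

Lemma lin_sub T : linear T -> forall u v, T (u - v) = T u - T v.
Proof. by move=> Tl u v; rewrite lin_add// lin_opp. Qed.

(** The Cauchy-Schwarz inequality of the form (u, v) |-> <T u, v>, at u = f and
    v = T f. *)
Lemma sqr_le_quadratic T (L : R) : symmetric_op T ->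
    (forall h, 0 <= dot (T h) h) -> 0 <= L ->
    (forall h, dot (T h) h <= L * dot h h) ->
  forall f, dot (T f) (T f) <= L * dot (T f) f.
Proof.
move=> Tsym T0 L0 TL f.
have Tl := symmetric_linear Tsym.
have bT : psd_form (fun u v => dot (T u) v).
  split => [u v|a u v w|//]; first by rewrite Tsym dotC.
  by rewrite Tl !dotE.
have := form_CS bT f (T f) => CS.
have := TL (T f); have := T0 f; have := form_ge0 dotP (T f).
rewrite le_eqVlt => /predU1P[<- *|x0 Tf0 TTf]; first by rewrite mulr_ge0.
rewrite -(ler_pM2r x0) -expr2 (le_trans CS)// (le_trans (ler_wpM2l Tf0 TTf))//.
by rewrite mulrCA mulrA.
Qed.

Definition complete_form := forall (u : nat -> H) (x : nat -> R),
  (forall n m, (n <= m)%N -> nrm (u n - u m) <= x n) ->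
  x n @[n --> \oo] --> 0 ->
  exists w, forall n, nrm (u n - w) <= x n.

(** * Spectral gap and kernel of a nonnegative contraction *)

Section Gap.
Variables (D : H -> H).
Hypotheses (Dsym : symmetric_op D) (D_ge0 : forall h, 0 <= dot (D h) h)
  (D_le1 : forall h, dot (D h) h <= dot h h).

Let Dl := symmetric_linear Dsym.

Lemma sqr_le_dot f : dot (D f) (D f) <= dot (D f) f.
Proof.
have := sqr_le_quadratic Dsym D_ge0 ler01 _ f; rewrite mul1r; apply.
by move=> h; rewrite mul1r.
Qed.

(** The resolvent bounds on the gap say that D - l is bounded below for
    0 < l < 2 d. If the bottom m of the spectrum of (D - d)^2 were smaller than
    d^2, then (D - d)^2 - m would factor through two such operators, hence be
    bounded below, against the choice of m. Expanding |(D - d) f|^2 >= d^2 |f|^2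
    gives the conclusion, that is D^2 >= 2 d D. *)
Lemma spectral_gap (d : R) : 0 < d ->
  (forall l, 0 < l < 2 * d -> exists2 c, 0 < c &
     forall h, c * dot h h <= dot (D h - l *: h) (D h - l *: h)) ->
  forall f, 2 * d * dot (D f) f <= dot (D f) (D f).
Proof.
move=> d0 inv.
have [B BE] : exists B : H -> H, forall h, B h = D h - d *: h.
  by exists (fun h => D h - d *: h).
have Bsym : symmetric_op B.
  by move=> u v; rewrite !BE !dotE Dsym.
pose lower := [set s : R | s <= d ^+ 2 /\
                           forall h, s * dot h h <= dot (B h) (B h)].
have lower0 : lower 0.
  by split=> [|h]; [rewrite sqr_ge0|rewrite mul0r (form_ge0 dotP)].
have lower_ne : lower !=set0 by exists 0.
have lower_ub : has_ubound lower by exists (d ^+ 2) => s [].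
(* m is the bottom of the spectrum of the square of B = D - d. *)
pose m := sup lower.
have m_ge0 : 0 <= m by exact: (ub_le_sup lower_ub lower0).
have m_le : m <= d ^+ 2 by apply: (ge_sup lower_ne) => s [].
have lower_m h : m * dot h h <= dot (B h) (B h).
  have [->|h0] := eqVneq (dot h h) 0; first by rewrite mulr0 (form_ge0 dotP).
  have hp : 0 < dot h h by rewrite lt_neqAle eq_sym h0 (form_ge0 dotP).
  rewrite -ler_pdivlMr//; apply: (ge_sup lower_ne) => s [_ /(_ h)].
  by rewrite ler_pdivlMr.
suff dm : d ^+ 2 <= m.
  move=> f; have := le_trans (ler_wpM2r (form_ge0 dotP f) dm) (lower_m f).
  by rewrite BE !dotE (dotC f (D f)) expr2; lra.
rewrite leNgt; apply/negP => md.
pose r := Num.sqrt m.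
have r2 : r ^+ 2 = m by rewrite sqr_sqrtr.
have r0 : 0 <= r by exact: sqrtr_ge0.
have rd : r < d by rewrite -ltr_sqr ?nnegrE ?(ltW d0)// r2.
have [|c1 c1_gt0 c1P] := inv (d - r); first by apply/andP; split; lra.
have [|c2 c2_gt0 c2P] := inv (d + r); first by apply/andP; split; lra.
(* B^2 - m = (D - (d + r)) (D - (d - r)), and both d - r and d + r lie in the
   gap, so B^2 - m is bounded below and m was not the largest lower bound. *)
have [T TE] : exists T : H -> H, forall h, T h = B (B h) - m *: h.
  by exists (fun h => B (B h) - m *: h).
have Tsym : symmetric_op T.
  by move=> u v; rewrite !TE !dotE !Bsym.
have TB h : dot (T h) h = dot (B h) (B h) - m * dot h h.
  by rewrite !TE !dotE Bsym.
have T0 h : 0 <= dot (T h) h by rewrite TB subr_ge0.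
have L0 : 0 <= 1 + d ^+ 2 by rewrite addr_ge0// sqr_ge0.
have TL h : dot (T h) h <= (1 + d ^+ 2) * dot h h.
  rewrite TB BE !dotE (dotC h (D h)).
  have := sqr_le_dot h; have := D_le1 h.
  have := mulr_ge0 m_ge0 (form_ge0 dotP h).
  have := mulr_ge0 (ltW d0) (D_ge0 h); rewrite expr2; lra.
have Tsq := sqr_le_quadratic Tsym T0 L0 TL.
have Tfact h : T h = (D (D h - (d - r) *: h) - (d + r) *: (D h - (d - r) *: h)).
  apply: dot_ext => w.
  by rewrite TE !BE !(lin_sub Dl) !(lin_scale Dl) !dotE -r2; ring.
pose c := c1 * c2 / (1 + d ^+ 2).
have L1 : 0 < 1 + d ^+ 2 by rewrite ltr_pwDl// sqr_ge0.
have c_gt0 : 0 < c by rewrite divr_gt0 ?mulr_gt0.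
have Tc h : c * dot h h <= dot (T h) h.
  rewrite /c mulrAC ler_pdivrMr// [leRHS]mulrC.
  apply: le_trans (Tsq h); rewrite Tfact; apply: le_trans (c2P _).
  by rewrite (mulrC c1) -mulrA ler_pM2l.
have : lower (Num.min (d ^+ 2) (m + c)).
  split=> [|h]; first by rewrite ge_min lexx.
  have: (m + c) * dot h h <= dot (B h) (B h).
    by have := Tc h; rewrite TB; lra.
  apply: le_trans; apply: ler_wpM2r; first exact: (form_ge0 dotP).
  by rewrite ge_min lexx orbT.
move=> /(ub_le_sup lower_ub); rewrite -/m leNgt lt_min md/=.
by rewrite ltrDl c_gt0.
Qed.

Section Kernel.
Variable t : R.
Hypotheses (Hcomplete : complete_form) (t_gt0 : 0 < t) (t_le1 : t <= 1)
  (gap : forall f, t * dot (D f) f <= dot (D f) (D f)).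

Let P f := f - D f.
Let e f : R := Num.sqrt (dot (D f) f).
Let r : R := Num.sqrt (1 - t).
Let C : R := (1 - r)^-1.

Let r_ge0 : 0 <= r. Proof. exact: sqrtr_ge0. Qed.

Let r_lt1 : r < 1.
Proof.
by rewrite -ltr_sqr ?nnegrE ?r_ge0 ?ler01// sqr_sqrtr ?subr_ge0// expr1n gtrBl.
Qed.

Let C_gt0 : 0 < C. Proof. by rewrite invr_gt0 subr_gt0. Qed.

Let nrmD_le f : nrm (D f) <= e f.
Proof. by rewrite ler_wsqrtr// sqr_le_dot. Qed.

Let nrmD_le_nrm f : nrm (D f) <= nrm f.
Proof. by rewrite (le_trans (nrmD_le f))// ler_wsqrtr. Qed.

Let e_contract f : e (P f) <= r * e f.
Proof.
rewrite -sqrtrM ?subr_ge0// ler_wsqrtr// /P (lin_sub Dl) !dotE.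
rewrite (Dsym (D f) f).
by have := D_le1 (D f); have := gap f; lra.
Qed.

Let e_iter f n : e (iter n P f) <= r ^+ n * e f.
Proof.
elim: n => [|n IH]; first by rewrite mul1r.
rewrite iterS (le_trans (e_contract _))// exprS -mulrA.
by rewrite ler_wpM2l.
Qed.

Let nrm_iter f n : nrm (f - iter n P f) <= C * e f.
Proof.
elim: n f => [f|n IH f].
  by rewrite subrr nrm0 mulr_ge0 ?sqrtr_ge0// ltW.
rewrite iterSr (le_trans (nrm_triangle (P f) _ _))//.
(* C was chosen as the sum of the geometric series of ratio r. *)
have -> : C * e f = e f + C * (r * e f).
  by rewrite /C; field; rewrite subr_eq0 gt_eqF.
apply: lerD; first by rewrite {1}/P opprB addrC subrK.
by rewrite (le_trans (IH _))// ler_pM2l.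
Qed.

Let nrm_iterB f n m : (n <= m)%N ->
  nrm (iter n P f - iter m P f) <= C * e f * r ^+ n.
Proof.
move=> nm; rewrite -(subnK nm) iterD (le_trans (nrm_iter _ _))//.
by rewrite -mulrA ler_pM2l// mulrC e_iter.
Qed.

Lemma cvg_mul_geometric (a : R) : a * r ^+ n @[n --> \oo] --> 0.
Proof.
rewrite -[X in _ --> X](mulr0 a); apply: cvgMr.
by apply: cvg_expr; rewrite ger0_norm.
Qed.

(** The gap makes the energy <D f, f> decrease by the factor 1 - t at each step
    of f |-> P f, while |f - P f|^2 <= <D f, f>. So P^n f converges
    geometrically, to a vector of the kernel of D whose distance to f is
    controlled by the energy of f: a Poincare inequality. *)
Lemma kernel_projection f :
  exists h, [/\ D h = 0, nrm (f - h) <= C * e f &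
                forall n, nrm (iter n P f - h) <= C * e f * r ^+ n].
Proof.
have [h hP] := Hcomplete (@nrm_iterB f) (cvg_mul_geometric _).
exists h; split=> //; last by have := hP 0%N; rewrite mulr1.
apply: (@nrm_le_cvg0 _ (fun n => ((C + 1) * e f) * r ^+ n)); last first.
  exact: cvg_mul_geometric.
move=> n; rewrite -[h](subrK (iter n P f)) (lin_add Dl).
rewrite (le_trans (nrmD _ _))// mulrDl mulrDl mul1r lerD//.
  by rewrite (le_trans (nrmD_le_nrm _))// nrmBC.
by rewrite (le_trans (nrmD_le _))// mulrC e_iter.
Qed.

(** If the kernel is trivial, the limit of P^n f is 0. *)
Lemma injective_coercive f : (forall h, D h = 0 -> h = 0) ->
  nrm f <= C ^+ 2 * nrm (D f).
Proof.
move=> Dinj; have [h [/Dinj-> + _]] := kernel_projection f.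
rewrite subr0 => fe.
have fC : nrm f ^+ 2 <= C ^+ 2 * dot (D f) f.
  have -> : dot (D f) f = e f ^+ 2 by rewrite sqr_sqrtr.
  by rewrite -exprMn ler_sqr ?nnegrE ?nrm_ge0 ?mulr_ge0 ?sqrtr_ge0 ?(ltW C_gt0).
rewrite expr2 in fC.
have := le_trans fC
  (ler_wpM2l (sqr_ge0 C) (le_trans (ler_norm _) (dot_le_nrm _ _))).
rewrite mulrA; have := nrm_ge0 f.
rewrite le_eqVlt => /predU1P[<- _|f0]; last by rewrite ler_pM2r.
by rewrite mulr_ge0 ?sqr_ge0 ?nrm_ge0.
Qed.

Lemma injective_surjective f : (forall h, D h = 0 -> h = 0) ->
  exists g, D g = f.
Proof.
(* The partial sums of the Neumann series of D^-1 = (1 - P)^-1. *)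
move=> Dinj; pose s := fix s n := if n is n'.+1 then f + P (s n') else 0.
have Ds n : D (s n) = f - iter n P f.
  elim: n => [|n IH]; first by rewrite (lin0 Dl) subrr.
  rewrite /= (lin_add Dl) {1}/P (lin_sub Dl) IH {3}/P (lin_sub Dl).
  by apply: dot_ext => w; rewrite !dotE; ring.
have sB n m : (n <= m)%N ->
    nrm (s n - s m) <= C ^+ 2 * (C * e f) * r ^+ n.
  move=> nm; rewrite (le_trans (injective_coercive _ Dinj))// -mulrA.
  rewrite ler_wpM2l ?sqr_ge0// (lin_sub Dl) !Ds.
  by rewrite opprB addrC addrA subrK nrmBC nrm_iterB.
have [g gP] := Hcomplete sB (cvg_mul_geometric _).
exists g; apply/eqP; rewrite -subr_eq0; apply/eqP.
apply: (@nrm_le_cvg0 _ (fun n => (C ^+ 2 * (C * e f) + C * e f) * r ^+ n)).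
  move=> n; rewrite mulrDl.
  rewrite (le_trans (nrm_triangle (D (s n)) _ _))// lerD//.
    by rewrite -(lin_sub Dl) (le_trans (nrmD_le_nrm _))// nrmBC.
  have [h [/Dinj-> _ /(_ n)]] := kernel_projection f.
  by rewrite Ds subr0 addrC addrA addNr sub0r nrmN.
exact: cvg_mul_geometric.
Qed.

End Kernel.
End Gap.

(** * The square root of 1 - P *)

Section SquareRoot.
Variable P : H -> H.
Hypotheses (Hcomplete : complete_form) (Psym : symmetric_op P)
  (P_contract : forall u, nrm (P u) <= nrm u).

Let Pl := symmetric_linear Psym.

(** The operators obtained from P by polynomials with nonnegative coefficients,
    with the value of the polynomial at 1, called its mass. *)
Inductive nonneg_poly : (H -> H) -> R -> Prop :=
| nonneg_polyX : nonneg_poly P 1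
| nonneg_polyZ a T c : 0 <= a -> nonneg_poly T c ->
    nonneg_poly (fun u => a *: T u) (a * c)
| nonneg_polyD T1 c1 T2 c2 : nonneg_poly T1 c1 -> nonneg_poly T2 c2 ->
    nonneg_poly (fun u => T1 u + T2 u) (c1 + c2)
| nonneg_polyM T1 c1 T2 c2 : nonneg_poly T1 c1 -> nonneg_poly T2 c2 ->
    nonneg_poly (fun u => T1 (T2 u)) (c1 * c2).

Lemma nonneg_poly_ge0 T c : nonneg_poly T c -> 0 <= c.
Proof.
by elim=> // *; [exact: mulr_ge0|exact: addr_ge0|exact: mulr_ge0].
Qed.

Lemma nonneg_poly_linear T c : nonneg_poly T c -> linear T.
Proof.
elim=> {T c}[|a T c _ _ IH b u v|T1 c1 T2 c2 _ IH1 _ IH2 b u v|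
             T1 c1 T2 c2 _ IH1 _ IH2 b u v]; first exact: Pl.
- by rewrite IH scalerDr !scalerA mulrC.
- by rewrite IH1 IH2 scalerDr addrACA.
- by rewrite IH2 IH1.
Qed.

Lemma nonneg_poly_comm T S c : linear S -> (forall u, S (P u) = P (S u)) ->
  nonneg_poly T c -> forall u, S (T u) = T (S u).
Proof.
move=> Sl SP; elim=> {T c}[|a T c _ _ IH|T1 c1 T2 c2 _ IH1 _ IH2|
                     T1 c1 T2 c2 _ IH1 _ IH2] u //.
- by rewrite (lin_scale Sl) IH.
- by rewrite (lin_add Sl) IH1 IH2.
- by rewrite IH1 IH2.
Qed.

Lemma nonneg_polyC T1 c1 T2 c2 : nonneg_poly T1 c1 -> nonneg_poly T2 c2 ->
  forall u, T1 (T2 u) = T2 (T1 u).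
Proof.
move=> p1 p2; apply: (nonneg_poly_comm _ _ p2).
  exact: nonneg_poly_linear p1.
by move=> u; rewrite (nonneg_poly_comm Pl _ p1).
Qed.

Lemma nonneg_poly_sym T c : nonneg_poly T c -> symmetric_op T.
Proof.
elim=> {T c}[|a T c _ _ IH|T1 c1 T2 c2 _ IH1 _ IH2|
             T1 c1 T2 c2 p1 IH1 p2 IH2] u v; first exact: Psym.
- by rewrite !dotE IH.
- by rewrite !dotE IH1 IH2.
- by rewrite IH1 IH2 (nonneg_polyC p1 p2).
Qed.

Definition convex_pred (X : H -> Prop) := forall u v t, 0 <= t <= 1 ->
  X u -> X v -> X (t *: u + (1 - t) *: v).

(** Up to its mass, such an operator is a convex combination of the powers of
    P. This one statement yields bounds for all norms that P contracts. *)
Lemma nonneg_poly_convex (X : H -> Prop) T c : convex_pred X ->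
    (forall u, X u -> X (P u)) -> nonneg_poly T c ->
  forall u, X u -> exists2 w, X w & T u = c *: w.
Proof.
move=> Xconv XP; elim=> {T c}[|a T c _ _ IH|T1 c1 T2 c2 p1 IH1 p2 IH2|
             T1 c1 T2 c2 p1 IH1 p2 IH2] u Xu.
- by exists (P u); [exact: XP|rewrite scale1r].
- by have [w Xw ->] := IH _ Xu; exists w; rewrite ?scalerA.
- have [w1 Xw1 ->] := IH1 _ Xu; have [w2 Xw2 ->] := IH2 _ Xu.
  have c1_ge0 := nonneg_poly_ge0 p1; have c2_ge0 := nonneg_poly_ge0 p2.
  have [c0|c0] := eqVneq (c1 + c2) 0.
    exists u => //.
    have [-> ->] : c1 = 0 /\ c2 = 0 by split; lra.
    by rewrite addr0 !scale0r addr0.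
  have cp : 0 < c1 + c2 by rewrite lt_neqAle eq_sym c0 addr_ge0.
  exists ((c1 / (c1 + c2)) *: w1 + (1 - c1 / (c1 + c2)) *: w2).
    apply: Xconv => //; apply/andP; split; first by rewrite divr_ge0// ltW.
    by rewrite ler_pdivrMr// mul1r lerDl.
  by rewrite scalerDr !scalerA; congr (_ *: _ + _ *: _); field.
- have [w2 Xw2 ->] := IH2 _ Xu; have [w1 Xw1 e1] := IH1 _ Xw2.
  exists w1 => //.
  by rewrite (lin_scale (nonneg_poly_linear p1)) e1 scalerA mulrC.
Qed.

Lemma nonneg_poly_nrm T c u : nonneg_poly T c -> nrm (T u) <= c * nrm u.
Proof.
move=> p; have [||w wu ->] := @nonneg_poly_convex (fun w =>
  nrm w <= nrm u) _ _ _ _ p u (lexx _).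
- move=> v w t /andP[t0 t1] vu wu; rewrite (le_trans (nrmD _ _))// !nrmZ.
  rewrite !ger0_norm ?subr_ge0//.
  have := ler_wpM2l t0 vu; have : (1 - t) * nrm w <= (1 - t) * nrm u.
    by rewrite ler_wpM2l// subr_ge0.
  lra.
- by move=> w; exact: le_trans.
- by rewrite nrmZ ger0_norm ?(nonneg_poly_ge0 p)// ler_wpM2l ?(nonneg_poly_ge0
    p).
Qed.

(** The classical iteration for 1 - sqrt (1 - P). If it converges to Q, then
    Q = (P + Q^2) / 2, so (1 - Q)^2 = 1 - P. *)
Fixpoint sqrt_iter n : H -> H :=
  if n is n'.+1 then fun u => 2^-1 *: (P u + sqrt_iter n' (sqrt_iter n' u))
    else fun=> 0.

Fixpoint iter_mass n : R := if n is n'.+1 then 2^-1 * (1 + iter_mass n' *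
  iter_mass n') else 0.

Lemma sqrt_iter_poly n : nonneg_poly (sqrt_iter n) (iter_mass n).
Proof.
elim: n => [|n IH] /=; last first.
  by apply: nonneg_polyZ; rewrite ?invr_ge0//; apply: nonneg_polyD;
    [exact: nonneg_polyX|exact: nonneg_polyM].
rewrite -[X in nonneg_poly _ X](mul0r 1).
rewrite (_ : (fun=> 0) = (fun u => 0 *: P u)).
  by apply: nonneg_polyZ => //; exact: nonneg_polyX.
by apply: funext => u; rewrite scale0r.
Qed.

(** Q_(n+2) - Q_(n+1) = (Q_(n+1) - Q_n) (Q_(n+1) + Q_n) / 2, as all these
    operators commute; so the increments have nonnegative coefficients, and the
    convergence of the masses controls that of the operators. *)
Lemma sqrt_iter_succ_poly n : nonneg_poly (fun u =>
  sqrt_iter n.+1 u - sqrt_iter n u) (iter_mass n.+1 - iter_mass n).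
Proof.
elim: n => [|n IH].
  rewrite (_ : (fun u => _) = (fun u => 2^-1 *: P u)).
    rewrite (_ : _ - _ = 2^-1 * 1); last by rewrite /=; ring.
    by apply: nonneg_polyZ; rewrite ?invr_ge0//; exact: nonneg_polyX.
  by apply: funext => u /=; rewrite addr0 subr0.
have := nonneg_polyM IH (nonneg_polyD (sqrt_iter_poly n.+1) (sqrt_iter_poly n)).
move=> /(@nonneg_polyZ 2^-1); rewrite invr_ge0 => /(_ (ler0n _ _)).
congr (nonneg_poly _ _); last first.
  have massS_E k : iter_mass k.+1 = 2^-1 * (1 + iter_mass k * iter_mass k) by
    [].
  by rewrite [X in _ = X - _]massS_E [X in _ = _ - X]massS_E; ring.
apply: funext => u.
rewrite !(lin_add (nonneg_poly_linear (sqrt_iter_poly _))).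
have iterS_E k v : sqrt_iter k.+1 v = 2^-1 *: (P v + sqrt_iter k (sqrt_iter k
  v)) by [].
rewrite [X in _ = X - _]iterS_E [X in _ = _ - X]iterS_E.
rewrite (nonneg_polyC (sqrt_iter_poly n.+1) (sqrt_iter_poly n)).
by apply: dot_ext => w; rewrite !dotE; ring.
Qed.

Lemma sqrt_iter_sub_poly n m : (n <= m)%N ->
  nonneg_poly (fun u => sqrt_iter m u - sqrt_iter n u) (iter_mass m - iter_mass
    n).
Proof.
move=> /subnK <-; elim: (m - n)%N => [|k IH].
  rewrite add0n subrr (_ : (fun u => _) = sqrt_iter 0);
    first exact: (sqrt_iter_poly 0).
  by apply: funext => u; rewrite subrr.
have := nonneg_polyD (sqrt_iter_succ_poly (k + n)) IH; rewrite -addSn.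
congr (nonneg_poly _ _); last by ring.
by apply: funext => u; rewrite addrA subrK.
Qed.

Lemma iter_mass_le1 n : 0 <= iter_mass n <= 1.
Proof.
elim: n => [|n /andP[q0 q1]]; first by rewrite lexx ler01.
have := ler_pM q0 q0 q1 q1; rewrite mulr1 => qq1 /=.
have := mulr_ge0 q0 q0; lra.
Qed.

Lemma iter_mass_cvg : exists q, (forall n, iter_mass n <= q) /\
  iter_mass n @[n --> \oo] --> q.
Proof.
have mass_nd : nondecreasing_seq iter_mass.
  by move=> n m nm; rewrite -subr_ge0;
    exact: (nonneg_poly_ge0 (sqrt_iter_sub_poly nm)).
have mass_ub : has_ubound (range iter_mass).
  by exists 1 => _ [n _ <-]; have /andP[] := iter_mass_le1 n.
exists (sup (range iter_mass)); split; last exact: nondecreasing_cvgn.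
by move=> n; apply: ub_le_sup => //; exists n.
Qed.

Definition closed_pred (X : H -> Prop) := forall (u : nat -> H) w,
  (forall n, X (u n)) -> nrm (u n - w) @[n --> \oo] --> 0 -> X w.

Lemma cvg_nrm_unique (u : nat -> H) v w : nrm (u n - v) @[n --> \oo] --> 0 ->
  nrm (u n - w) @[n --> \oo] --> 0 -> v = w.
Proof.
move=> uv uw; apply/eqP; rewrite -subr_eq0; apply/eqP.
apply: (@nrm_le_cvg0 _ (fun n => nrm (u n - v) + nrm (u n - w))).
  by move=> n; rewrite (nrmBC (u n)) nrm_triangle.
by rewrite -[X in _ --> X]addr0; exact: cvgD.
Qed.

Lemma cvg_nrm_bounded (T : H -> H) L (u : nat -> H) w : linear T ->
  (forall v, nrm (T v) <= L * nrm v) -> nrm (u n - w) @[n --> \oo] --> 0 ->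
  nrm (T (u n) - T w) @[n --> \oo] --> 0.
Proof.
move=> Tl TL uw.
apply: (@squeeze_cvgr _ _ _ _ (cst 0) (fun n => L * nrm (u n - w))).
- by near=> n; rewrite nrm_ge0/= -(lin_sub Tl) TL.
- exact: cvg_cst.
- by rewrite -[X in _ --> X](mulr0 L); exact: cvgMr.
Unshelve. all: by end_near. Qed.

Lemma sqrt_iteration_limit : exists Q : H -> H,
  [/\ forall u, nrm (sqrt_iter n u - Q u) @[n --> \oo] --> 0,
      forall u, Q u = 2^-1 *: (P u + Q (Q u)),
      symmetric_op Q & forall u, nrm (Q u) <= nrm u].
Proof.
have [q [q_ge q_cvg]] := iter_mass_cvg.
have Qbound u n m : (n <= m)%N -> nrm (sqrt_iter n u - sqrt_iter m u) <= (q -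
  iter_mass n) * nrm u.
  move=> nm; rewrite nrmBC (le_trans (nonneg_poly_nrm _ (sqrt_iter_sub_poly
    nm)))//.
  by rewrite ler_wpM2r ?nrm_ge0// lerD2r.
have bound0 u : (q - iter_mass n) * nrm u @[n --> \oo] --> 0.
  rewrite -[X in _ --> X](mul0r (nrm u)); apply: cvgMl.
  by rewrite -[X in _ --> X](subrr q); apply: cvgB => //; exact: cvg_cst.
have /choice[Q QP] u : exists w,
    forall n, nrm (sqrt_iter n u - w) <= (q - iter_mass n) * nrm u.
  exact: Hcomplete (@Qbound u) (bound0 u).
have Qcvg u : nrm (sqrt_iter n u - Q u) @[n --> \oo] --> 0.
  apply: (@squeeze_cvgr _ _ _ _ (cst 0) (fun n =>
    (q - iter_mass n) * nrm u)) => //.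
    by near=> n; rewrite nrm_ge0/= QP.
  exact: cvg_cst.
have sqrt_iter_contract n u : nrm (sqrt_iter n u) <= nrm u.
  rewrite (le_trans (nonneg_poly_nrm _ (sqrt_iter_poly n)))// ler_piMl
    ?nrm_ge0//.
  by have /andP[] := iter_mass_le1 n.
have dot_cvg u v : dot (sqrt_iter n u) v @[n --> \oo] --> dot (Q u) v.
  apply/subr_cvg0.
  apply: (@squeeze_cvgr _ _ _ _ (fun n =>
    - (nrm (sqrt_iter n u - Q u) * nrm v)) (fun n =>
    nrm (sqrt_iter n u - Q u) * nrm v)).
  - near=> n; rewrite -ler_norml.
    by have := dot_le_nrm (sqrt_iter n u - Q u) v; rewrite !dotE.
  - rewrite -[X in _ --> X]oppr0; apply: cvgN.
    by rewrite -[X in _ --> X](mul0r (nrm v)); exact: cvgMl.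
  - by rewrite -[X in _ --> X](mul0r (nrm v)); exact: cvgMl.
exists Q; split=> //.
- move=> u; apply: (cvg_nrm_unique (u := fun n => sqrt_iter n.+1 u)).
    by have := Qcvg u; rewrite -(cvg_shiftS (fun n =>
      nrm (sqrt_iter n u - Q u))).
  apply: (@squeeze_cvgr _ _ _ _ (cst 0) (fun n =>
    nrm (sqrt_iter n u - Q u) + nrm (sqrt_iter n (Q u) - Q (Q u)))).
  + near=> n; rewrite nrm_ge0/= -scalerBr nrmZ ger0_norm ?invr_ge0//.
    rewrite opprD addrACA subrr add0r.
    have := nrm_triangle (sqrt_iter n (Q u)) (sqrt_iter n (sqrt_iter n u)) (Q
      (Q u)).
    rewrite -(lin_sub (nonneg_poly_linear (sqrt_iter_poly n))).
    have := sqrt_iter_contract n (sqrt_iter n u - Q u).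
    have := nrm_ge0 (sqrt_iter n (sqrt_iter n u) - Q (Q u)); lra.
  + exact: cvg_cst.
  + by rewrite -[X in _ --> X]addr0; apply: cvgD; exact: Qcvg.
- move=> u v; rewrite [RHS]dotC.
  rewrite -(cvg_lim (@Rhausdorff R) (dot_cvg u v)).
  rewrite -(cvg_lim (@Rhausdorff R) (dot_cvg v u)).
  suff -> : (fun n => dot (sqrt_iter n u) v) = (fun n =>
    dot (sqrt_iter n v) u) by [].
  apply: funext => n.
  by rewrite (nonneg_poly_sym (sqrt_iter_poly n)) dotC.
- move=> u; rewrite -subr_le0; apply: (le0_cvg0 _ (bound0 u)) => n.
  rewrite lerBlDr -(subrK (sqrt_iter n u) (Q u)) (le_trans (nrmD _ _))//.
  by rewrite lerD// nrmBC.
Unshelve. all: by end_near. Qed.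

Section Limit.
Variable Q : H -> H.
Hypotheses (Qcvg : forall u, nrm (sqrt_iter n u - Q u) @[n --> \oo] --> 0).

Lemma limit_commute T L : linear T -> (forall u, nrm (T u) <= L * nrm u) ->
  (forall u, T (P u) = P (T u)) -> forall u, T (Q u) = Q (T u).
Proof.
move=> Tl TL TP u.
apply: (cvg_nrm_unique (u := fun n => T (sqrt_iter n u))).
  exact: cvg_nrm_bounded Tl TL (Qcvg u).
under eq_fun do rewrite (nonneg_poly_comm Tl TP (sqrt_iter_poly _)).
exact: Qcvg.
Qed.

(** The iterates have mass at most 1, so that they map a convex P-stable set
    containing 0 into itself. Applied below to balls of l^p. *)
Lemma limit_convex (X : H -> Prop) u : convex_pred X -> closed_pred X -> X 0 ->
  (forall v, X v -> X (P v)) -> X u -> X (Q u).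
Proof.
move=> Xconv Xcl X0 XP Xu; apply: (Xcl (fun n => sqrt_iter n u)) (Qcvg u) => n.
have [w Xw ->] := nonneg_poly_convex Xconv XP (sqrt_iter_poly n) Xu.
by rewrite -[_ *: w]addr0 -(scaler0 _ (1 - iter_mass n)); apply: Xconv => //;
  exact: iter_mass_le1.
Qed.
End Limit.

End SquareRoot.

(** The operators commute and have the same square, so h = (S1 - S2) u satisfies
    (S1 + S2) h = 0. Hence the forms of S1 and S2 both vanish at h, which gives
    S1 h = S2 h = 0 and |h|^2 = <u, (S1 - S2) h> = 0. *)
Lemma sqrt_unique S1 S2 (L1 L2 : R) : symmetric_op S1 -> symmetric_op S2 ->
    0 <= L1 -> 0 <= L2 ->
    (forall u, 0 <= dot (S1 u) u <= L1 * dot u u) ->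
    (forall u, 0 <= dot (S2 u) u <= L2 * dot u u) ->
    (forall u, S1 (S1 u) = S2 (S2 u)) -> (forall u, S1 (S2 u) = S2 (S1 u)) ->
  forall u, S1 u = S2 u.
Proof.
move=> sym1 sym2 L1_ge0 L2_ge0 bnd1 bnd2 sq12 comm12 u.
have [h hE] : exists h, h = S1 u - S2 u by exists (S1 u - S2 u).
have sum0 : S1 h + S2 h = 0.
  rewrite hE (lin_sub (symmetric_linear sym1)) (lin_sub (symmetric_linear
    sym2)).
  by rewrite sq12 comm12 subrKA subrr.
have : dot (S1 h) h + dot (S2 h) h = 0 by rewrite -(formDl dotP) sum0 (form0l
  dotP).
have /andP[S1h0 _] := bnd1 h; have /andP[S2h0 _] := bnd2 h.
move=> /eqP; rewrite paddr_eq0// => /andP[/eqP S1h /eqP S2h].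
(* A nonnegative operator kills the vectors on which its form vanishes. *)
have kill S L : symmetric_op S -> 0 <= L ->
    (forall u, 0 <= dot (S u) u <= L * dot u u) -> dot (S h) h = 0 -> S h = 0.
  move=> Ssym L0 bnd Sh; apply: (inner_eq0 dotP); apply/eqP.
  rewrite eq_le (form_ge0 dotP) andbT -(mulr0 L) -Sh.
  by apply: sqr_le_quadratic => // v; have /andP[] := bnd v.
apply/eqP; rewrite -subr_eq0; apply/eqP/(inner_eq0 dotP).
rewrite -hE.
have -> : dot h h = dot (S1 u) h - dot (S2 u) h by rewrite {1}hE !dotE.
rewrite sym1 sym2 (kill S1 L1)// (kill S2 L2)//.
by rewrite subrr.
Qed.

End InnerProduct.

(** * Sums over a discrete set *)

Section Esum.
Context {R : realType} {V : choiceType}.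
Implicit Types (a b : V -> R).
Local Open Scope ereal_scope.

Lemma esum_le_fset (a : V -> \bar R) (M : \bar R) (A : set V) :
  (forall F : {fset V}, [set` F] `<=` A -> \sum_(x <- F) a x <= M) ->
  \esum_(x in A) a x <= M.
Proof.
move=> aM; apply: ge_ereal_sup => _ [F [finF FA] <-].
by rewrite fsbig_finite//=; apply: aM; rewrite fset_setK.
Qed.

Lemma fset_le_esum (a : V -> \bar R) (A : set V) (F : {fset V}) :
  [set` F] `<=` A -> \sum_(x <- F) a x <= \esum_(x in A) a x.
Proof.
move=> FA; apply: esum_ge; exists [set` F]; first by split.
by rewrite fsbig_finite//= set_fsetK.
Qed.

Lemma esum_seq (r : seq V) (a : V -> \bar R) : uniq r ->
  (forall x, 0 <= a x) -> (forall x, x \notin r -> a x = 0) ->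
  \esum_(x in [set: V]) a x = \sum_(x <- r) a x.
Proof.
move=> ur a0 ar; rewrite fsbig_seq// -esum_fset//.
rewrite [RHS]esum_mkcond; apply: eq_esum => x _.
by case: ifPn => //; rewrite mem_setE => /ar.
Qed.

Lemma esum_exchange {U : choiceType} (a : V -> U -> \bar R) :
  (forall x y, 0 <= a x y) ->
  \esum_(x in [set: V]) \esum_(y in [set: U]) a x y =
  \esum_(y in [set: U]) \esum_(x in [set: V]) a x y.
Proof.
move=> a0; rewrite !esum_esum//.
rewrite (reindex_esum ([set: U] `*`` fun=> [set: V]) _ (fun z => (z.2, z.1)))//.
split=> [z //|[? ?] [? ?] _ _ [-> ->] //|[x y] _]; by exists (y, x).
Qed.

Lemma esumZ_le (c : R) a : (0 <= c)%R -> (forall x, 0 <= a x)%R ->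
  \esum_(x in [set: V]) (c * a x)%:E <= c%:E * \esum_(x in [set: V]) (a x)%:E.
Proof.
move=> c0 a0; apply: esum_le_fset => F _.
under eq_bigr do rewrite EFinM.
rewrite -ge0_sume_distrr; last by move=> x _; rewrite lee_fin.
by apply: lee_wpmul2l; rewrite ?lee_fin//; exact: fset_le_esum.
Qed.

Lemma esumZ (c : R) a : (0 <= c)%R -> (forall x, 0 <= a x)%R ->
  \esum_(x in [set: V]) (c * a x)%:E = c%:E * \esum_(x in [set: V]) (a x)%:E.
Proof.
move=> c0 a0; apply/eqP; rewrite eq_le esumZ_le//=.
have [->|cn0] := eqVneq c 0%R.
  by rewrite mul0e esum_ge0// => x _; rewrite mul0r.
have cp : (0 < c)%R by rewrite lt_neqAle eq_sym cn0.
rewrite -[leRHS]mul1e -(divff cn0) EFinM -muleA lee_wpmul2l ?lee_fin//.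
apply: le_trans (esumZ_le _ _); rewrite ?invr_ge0//; last first.
  by move=> x; exact: mulr_ge0.
by apply: le_esum => x _; rewrite mulKf.
Qed.

(** Fatou's lemma for the counting measure, where it reduces to finite sums. *)
Lemma esum_fatou (a : nat -> V -> R) b (M : R) : 
  (forall x, a n x @[n --> \oo] --> b x) ->
  (forall n, \esum_(x in [set: V]) (a n x)%:E <= M%:E) ->
  \esum_(x in [set: V]) (b x)%:E <= M%:E.
Proof.
move=> ab aM; apply: esum_le_fset => F _; rewrite sumEFin lee_fin.
have sumcvg : (\sum_(x <- F) a n x)%R @[n --> \oo] --> (\sum_(x <- F) b x)%R.
  elim: (F : seq V) => [|y s IH].
    by under eq_fun do rewrite big_nil; rewrite big_nil; exact: cvg_cst.
  under eq_fun do rewrite big_cons; rewrite big_cons; exact: cvgD.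
rewrite -(cvg_lim (@Rhausdorff R) sumcvg); apply: limr_le.
  exact/cvgP/sumcvg.
apply: nearW => n; rewrite -lee_fin -sumEFin; apply: le_trans (aM n).
exact: fset_le_esum.
Qed.

End Esum.

Section Tsum.
Context {R : realType} {V : choiceType}.
Implicit Types (f g h a b : V -> R).

Definition abs_summable f := (\esum_(x in [set: V]) `|f x|%:E < +oo)%E.

Definition tsum f : R :=
  fine (\esum_(x in [set: V]) (f^\+ x)%:E)%E -
  fine (\esum_(x in [set: V]) (f^\- x)%:E)%E.

Lemma abs_summable_le f g : (forall x, `|f x| <= `|g x|) ->
  abs_summable g -> abs_summable f.
Proof.
by move=> fg; apply: le_lt_trans; apply: le_esum => x _; rewrite lee_fin.
Qed.

Lemma abs_summableD f g : abs_summable f -> abs_summable g ->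
  abs_summable (fun x => f x + g x).
Proof.
move=> sf sg; have := lte_add_pinfty sf sg; rewrite -esumD//.
by apply: le_lt_trans; apply: le_esum => x _; rewrite lee_fin ler_normD.
Qed.

Lemma abs_summableZ c f : abs_summable f -> abs_summable (fun x => c * f x).
Proof.
move=> sf; rewrite /abs_summable; under eq_esum do rewrite normrM.
by rewrite esumZ//; apply: lte_mul_pinfty; rewrite ?lee_fin.
Qed.

Lemma abs_summableB f g : abs_summable f -> abs_summable g ->
  abs_summable (fun x => f x - g x).
Proof.
move=> sf sg; apply: (abs_summableD sf).
by apply: abs_summable_le sg => x; rewrite normrN.
Qed.

Lemma abs_summable_norm f : abs_summable f -> abs_summable (fun x => `|f x|).
Proof. by apply: abs_summable_le => x; rewrite normr_id. Qed.

Lemma abs_summable_pos f : abs_summable f -> abs_summable f^\+.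
Proof.
apply: abs_summable_le => x; rewrite /funrpos ger0_norm ?le_max ?lexx ?orbT//.
by rewrite ge_max ler_norm normr_ge0.
Qed.

Lemma abs_summable_neg f : abs_summable f -> abs_summable f^\-.
Proof.
apply: abs_summable_le => x; rewrite /funrneg ger0_norm ?le_max ?lexx ?orbT//.
by rewrite ge_max normr_ge0 andbT -normrN ler_norm.
Qed.

Lemma tsum_ge0E a : (forall x, 0 <= a x) ->
  tsum a = fine (\esum_(x in [set: V]) (a x)%:E)%E.
Proof.
move=> a0; rewrite /tsum [X in _ - fine X]esum1 ?subr0.
  by congr (fine _); apply: eq_esum => x _; rewrite /funrpos; congr EFin;
    exact/max_idPl.
by move=> x _; congr EFin; apply/max_idPr; rewrite lerNl oppr0.
Qed.

Lemma esum_tsum a : (forall x, 0 <= a x) -> abs_summable a ->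
  (\esum_(x in [set: V]) (a x)%:E)%E = (tsum a)%:E.
Proof.
move=> a0 sa; rewrite tsum_ge0E// fineK// ge0_fin_numE.
  by apply: le_lt_trans sa; apply: le_esum => x _; rewrite lee_fin ler_norm.
by apply: esum_ge0 => x _; rewrite lee_fin.
Qed.

Lemma tsum_posneg f : tsum f = tsum f^\+ - tsum f^\-.
Proof.
rewrite (tsum_ge0E (a := f^\+)); last by move=> x; exact: funrpos_ge0.
by rewrite (tsum_ge0E (a := f^\-))// => x; exact: funrneg_ge0.
Qed.

Let tsumD_ge0 a b : (forall x, 0 <= a x) -> (forall x, 0 <= b x) ->
  abs_summable a -> abs_summable b -> tsum (fun x =>
    a x + b x) = tsum a + tsum b.
Proof.
move=> a0 b0 sa sb.
have ab0 x : 0 <= a x + b x by exact: addr_ge0.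
apply: EFin_inj; rewrite (EFinD (tsum a)) -(esum_tsum a0 sa) -(esum_tsum b0 sb).
rewrite -(esum_tsum ab0 (abs_summableD sa sb)) -esumD// => x _.
  by rewrite lee_fin.
by rewrite lee_fin.
Qed.

(** The sum does not depend on the decomposition into nonnegative parts. *)
Lemma tsum_subE f a b : (forall x, 0 <= a x) -> (forall x, 0 <= b x) ->
  abs_summable a -> abs_summable b -> (forall x, f x = a x - b x) ->
  tsum f = tsum a - tsum b.
Proof.
move=> a0 b0 sa sb fab.
have sf : abs_summable f.
  by rewrite (_ : f = fun x => a x - b x); [exact: abs_summableB|exact/funext].
have p0 x : 0 <= f^\+ x by rewrite le_max lexx orbT.
have n0 x : 0 <= f^\- x by rewrite le_max lexx orbT.
have : tsum (fun x => f^\+ x + b x) = tsum (fun x => f^\- x + a x).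
  congr tsum; apply: funext => x; rewrite /funrpos /funrneg fab.
  by have [ab|ab] := leP 0 (a x - b x); rewrite ?maxEle; case: ifP; lra.
rewrite !tsumD_ge0//; [|exact: abs_summable_neg|exact: abs_summable_pos].
by rewrite (tsum_posneg f); lra.
Qed.

Lemma tsumD f g : abs_summable f -> abs_summable g ->
  tsum (fun x => f x + g x) = tsum f + tsum g.
Proof.
move=> sf sg.
have p0 h x : 0 <= h^\+ x by rewrite le_max lexx orbT.
have n0 h x : 0 <= h^\- x by rewrite le_max lexx orbT.
have sfp := abs_summable_pos sf; have sgp := abs_summable_pos sg.
have sfn := abs_summable_neg sf; have sgn := abs_summable_neg sg.
rewrite (@tsum_subE _ (fun x => f^\+ x + g^\+ x) (fun x => f^\- x + g^\- x)).
- by rewrite !tsumD_ge0// (tsum_posneg f) (tsum_posneg g); ring.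
- by move=> x; exact: addr_ge0.
- by move=> x; exact: addr_ge0.
- exact: abs_summableD.
- exact: abs_summableD.
- move=> x; rewrite opprD addrACA.
  by rewrite /funrpos /funrneg; congr (_ + _); rewrite /Num.max;
    case: ifP => ?; case: ifP => ?; lra.
Qed.

Lemma tsumZ c f : abs_summable f -> tsum (fun x => c * f x) = c * tsum f.
Proof.
have Z_ge0 d a : 0 <= d -> (forall x, 0 <= a x) -> abs_summable a ->
    tsum (fun x => d * a x) = d * tsum a.
  move=> d0 a0 sa; have da0 x : 0 <= d * a x by exact: mulr_ge0.
  apply: EFin_inj; rewrite (EFinM d) -(esum_tsum a0 sa) -esumZ//.
  by rewrite -(esum_tsum da0 (abs_summableZ d sa)).
move=> sf.
wlog c0 : c / 0 <= c.
  move=> H; have [/H//|c0] := leP 0 c.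
  have := tsumD (abs_summableZ c sf) (abs_summableZ (- c) sf).
  rewrite (H (- c)) ?oppr_ge0 ?ltW//.
  rewrite tsum_ge0E => [|x]; last by rewrite mulNr subrr.
  by rewrite esum1 => [/=|x _]; [lra|rewrite mulNr subrr].
have p0 h x : 0 <= h^\+ x by rewrite le_max lexx orbT.
have n0 h x : 0 <= h^\- x by rewrite le_max lexx orbT.
rewrite (@tsum_subE _ (fun x => c * f^\+ x) (fun x => c * f^\- x)).
- rewrite (tsum_posneg f) mulrBr.
  by rewrite !Z_ge0//; [exact: abs_summable_neg|exact: abs_summable_pos].
- by move=> x; exact: mulr_ge0.
- by move=> x; exact: mulr_ge0.
- exact/abs_summableZ/abs_summable_pos.
- exact/abs_summableZ/abs_summable_neg.
- move=> x; rewrite -mulrBr; congr (_ * _).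
  by rewrite /funrpos /funrneg /Num.max; case: ifP => ?; case: ifP => ?; lra.
Qed.

Lemma tsum_ge0 f : (forall x, 0 <= f x) -> 0 <= tsum f.
Proof.
by move=> f0; rewrite tsum_ge0E// fine_ge0// esum_ge0// => x _; rewrite lee_fin.
Qed.

Lemma tsumN f : abs_summable f -> tsum (fun x => - f x) = - tsum f.
Proof.
by move=> sf; under eq_fun do rewrite -mulN1r; rewrite tsumZ// mulN1r.
Qed.

Lemma tsumB f g : abs_summable f -> abs_summable g ->
  tsum (fun x => f x - g x) = tsum f - tsum g.
Proof.
move=> sf sg; rewrite tsumD ?tsumN//.
by apply: abs_summable_le sg => x; rewrite normrN.
Qed.

Lemma le_tsum f g : abs_summable f -> abs_summable g ->
  (forall x, f x <= g x) -> tsum f <= tsum g.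
Proof.
move=> sf sg fg; rewrite -subr_ge0 -tsumB//; apply: tsum_ge0 => x.
by rewrite subr_ge0.
Qed.

Lemma le_tsum_at f x : (forall y, 0 <= f y) -> abs_summable f -> f x <= tsum f.
Proof.
move=> f0 sf; rewrite -lee_fin -esum_tsum//.
by have := @fset_le_esum R V (EFin \o f) setT [fset x]%fset;
  rewrite big_seq_fset1; apply.
Qed.

Lemma tsum_seq (r : seq V) f : uniq r -> (forall x, x \notin r -> f x = 0) ->
  tsum f = \sum_(x <- r) f x.
Proof.
move=> ur fr.
have E (a : V -> R) : (forall x, 0 <= a x) -> (forall x, x \notin r ->
  a x = 0) ->
    fine (\esum_(x in [set: V]) (a x)%:E)%E = \sum_(x <- r) a x.
  move=> a0 ar; rewrite (esum_seq ur)//; first by rewrite sumEFin.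
  by move=> x /ar ->.
rewrite /tsum !E -?sumrB; last first.
- by move=> x /fr; rewrite /funrpos => ->; rewrite maxxx.
- by move=> x; rewrite le_max lexx orbT.
- by move=> x /fr; rewrite /funrneg => ->; rewrite oppr0 maxxx.
- by move=> x; rewrite le_max lexx orbT.
apply: eq_bigr => x _.
by rewrite /funrpos /funrneg /Num.max; case: ifP => ?; case: ifP => ?; lra.
Qed.

End Tsum.

(** * The Hilbert space of square summable functions *)

Section L2Space.
Context {R : realType} {V : choiceType} (w : V -> R).

Definition sqr_summable (f : V -> R) := abs_summable (fun x => f x ^+ 2 * w x).

Definition l2_pred : {pred V -> R^o} := fun f => `[< sqr_summable f >].

Lemma sqr_summable_linear a (f g : V -> R) : sqr_summable f ->
  sqr_summable g -> sqr_summable (fun x => a * f x + g x).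
Proof.
move=> sf sg.
apply: abs_summable_le (abs_summableD (abs_summable_norm (abs_summableZ (2 * a
  ^+ 2) sf))
                                      (abs_summable_norm (abs_summableZ 2 sg))).
move=> x; rewrite (@ger0_norm _ (_ + _)); last by rewrite addr_ge0.
have le : (a * f x + g x) ^+ 2 <= 2 * a ^+ 2 * f x ^+ 2 + 2 * g x ^+ 2.
  by have := sqr_ge0 (a * f x - g x); lra.
have norm_sqrM (b c : R) : `|b ^+ 2 * c| = b ^+ 2 * `|c|.
  by rewrite normrM ger0_norm ?sqr_ge0.
have c_ge0 : 0 <= 2 * a ^+ 2 by rewrite mulr_ge0 ?sqr_ge0.
rewrite (normrM (2 * a ^+ 2)) (ger0_norm c_ge0) (normrM 2) !norm_sqrM.
rewrite (ger0_norm (ler0n _ 2)).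
by have := ler_wpM2r (normr_ge0 (w x)) le; lra.
Qed.

Lemma sqr_summable0 : sqr_summable (fun=> 0).
Proof.
by rewrite /sqr_summable /abs_summable esum1// => x _;
  rewrite expr0n mul0r normr0.
Qed.

Lemma l2_submod : submod_closed l2_pred.
Proof.
split; first by apply/asboolP; exact: sqr_summable0.
by move=> a f g /asboolP sf /asboolP sg; apply/asboolP/sqr_summable_linear.
Qed.

HB.instance Definition _ := GRing.isSubmodClosed.Build R (V ->
  R^o) l2_pred l2_submod.

Record L2 := MkL2 { l2_fun : V -> R^o ; l2_funP : l2_fun \in l2_pred }.
HB.instance Definition _ := [isSub for l2_fun].
HB.instance Definition _ := [Choice of L2 by <:].
HB.instance Definition _ := [SubChoice_isSubLmodule of L2 by <:].

Definition l2_ip (u v : L2) : R := tsum (fun x =>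
  l2_fun u x * l2_fun v x * w x).

Lemma l2_funD u v x : l2_fun (u + v) x = l2_fun u x + l2_fun v x.
Proof. by []. Qed.

Lemma l2_funB u v x : l2_fun (u - v) x = l2_fun u x - l2_fun v x.
Proof. by []. Qed.

Lemma l2_funZ a u x : l2_fun (a *: u) x = a * l2_fun u x.
Proof. by []. Qed.

Lemma l2_fun0 x : l2_fun 0 x = 0.
Proof. by []. Qed.

Lemma l2_ext u v : (forall x, l2_fun u x = l2_fun v x) -> u = v.
Proof. by move=> uv; apply: val_inj; apply: funext. Qed.

Lemma l2_sqr_summable u : sqr_summable (l2_fun u).
Proof. exact: asboolW (l2_funP u). Qed.

Lemma sqr_summable_prod (f g : V -> R) : sqr_summable f -> sqr_summable g ->
  abs_summable (fun x => f x * g x * w x).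
Proof.
move=> sf sg; apply: abs_summable_le (abs_summableD
  (abs_summable_norm sf) (abs_summable_norm sg)) => x.
rewrite (@ger0_norm _ (_ + _)); last by rewrite addr_ge0.
rewrite !(normrM _ (w x)) -mulrDl ler_wpM2r// !normrX normrM.
rewrite -subr_ge0.
have := sqr_ge0 (`|f x| - `|g x|); have := sqr_ge0 (`|f x| + `|g x|); lra.
Qed.

Hypothesis w_gt0 : forall x, 0 < w x.

Lemma l2_ipP : inner_product l2_ip.
Proof.
have sM u v := sqr_summable_prod (l2_sqr_summable u) (l2_sqr_summable v).
split; first split.
- by move=> u v; congr tsum; apply: funext => x; rewrite (mulrC (l2_fun u x)).
- move=> a u v z; rewrite /l2_ip -tsumZ// -tsumD//; last exact: abs_summableZ.
  by congr tsum; apply: funext => x; rewrite l2_funD l2_funZ; ring.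
- by move=> u; apply: tsum_ge0 => x;
    rewrite mulr_ge0 ?(ltW (w_gt0 x))// -expr2 sqr_ge0.
- move=> u u0; apply: l2_ext => x; rewrite l2_fun0.
  have p0 y : 0 <= l2_fun u y * l2_fun u y * w y.
    by rewrite mulr_ge0 ?(ltW (w_gt0 y))// -expr2 sqr_ge0.
  have := le_tsum_at x p0 (sM u u); rewrite -/(l2_ip u u) u0 =>
    /(conj (p0 x))/andP.
  rewrite -eq_le eq_sym mulf_eq0 (gt_eqF (w_gt0 x)) orbF -expr2 sqrf_eq0.
  by move/eqP.
Qed.

Local Notation nrm := (nrm l2_ip).

Lemma l2_ip_sqr u : l2_ip u u = tsum (fun x => l2_fun u x ^+ 2 * w x).
Proof. by congr tsum; apply: funext => x; rewrite expr2. Qed.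

Lemma l2_eval_le u x : `|l2_fun u x| <= nrm u / Num.sqrt (w x).
Proof.
rewrite ler_pdivlMr ?sqrtr_gt0// -ler_sqr ?nnegrE ?mulr_ge0 ?sqrtr_ge0//.
rewrite (sqr_nrm l2_ipP) exprMn sqr_sqrtr ?(ltW (w_gt0 x))// real_normK
  ?num_real//.
rewrite l2_ip_sqr; apply: (@le_tsum_at _ _ (fun x => l2_fun u x ^+ 2 * w x)).
  by move=> y; rewrite mulr_ge0 ?sqr_ge0 ?(ltW (w_gt0 y)).
exact: l2_sqr_summable.
Qed.

Lemma l2_eval_cvg (u : nat -> L2) z x : nrm (u n - z) @[n --> \oo] --> 0 ->
  l2_fun (u n) x @[n --> \oo] --> l2_fun z x.
Proof.
move=> uz; apply/subr_cvg0.
have b0 : nrm (u n - z) / Num.sqrt (w x) @[n --> \oo] --> 0.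
  by rewrite -[X in _ --> X](mul0r (Num.sqrt (w x))^-1); exact: cvgMl.
apply: (@squeeze_cvgr _ _ _ _ (fun n => - (nrm (u n - z) / Num.sqrt (w x)))
                             (fun n => nrm (u n - z) / Num.sqrt (w x))) => //.
  by near=> n; rewrite -ler_norml -l2_funB l2_eval_le.
by rewrite -[X in _ --> X]oppr0; exact: cvgN.
Unshelve. all: by end_near. Qed.

Lemma cauchy_bound_cvg (a b : nat -> R) :
  (forall n m, (n <= m)%N -> `|a n - a m| <= b n) -> b n @[n --> \oo] --> 0 ->
  exists l : R, a n @[n --> \oo] --> l.
Proof.
move=> ab b0; suff /cvg_ex[l al] : cvg (a n @[n --> \oo]) by exists l.
apply/cauchy_cvgP/cauchy_exP => e e0.
move/cvgrPdist_lt : b0 => /(_ e e0)[N _ bN].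
exists (a N), N => // m /= Nm; rewrite /ball/= .
apply: le_lt_trans (ab _ _ Nm) _.
by have := bN N (leqnn N); rewrite sub0r normrN; apply: le_lt_trans;
  exact: ler_norm.
Qed.

(** Evaluations are continuous, so a Cauchy sequence converges pointwise;
    Fatou's lemma bounds the distance to the pointwise limit. *)
Lemma l2_complete : complete_form l2_ip.
Proof.
move=> u b ub b0.
have b_ge0 n : 0 <= b n by apply: le_trans (ub n n (leqnn n)); exact: nrm_ge0.
have /choice[f uf] x : exists l : R, l2_fun (u n) x @[n --> \oo] --> l.
  apply: (@cauchy_bound_cvg _ (fun n => b n / Num.sqrt (w x))).
    move=> n m nm; rewrite -l2_funB (le_trans (l2_eval_le _ _))//.
    by rewrite ler_wpM2r ?invr_ge0 ?sqrtr_ge0// ub.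
  by rewrite -[X in _ --> X](mul0r (Num.sqrt (w x))^-1); exact: cvgMl.
have bound n : (\esum_(x in [set: V]) (((l2_fun (u n) x - f x) ^+ 2 * w x)%:E)
  <= (b n ^+ 2)%:E)%E.
  apply: (@esum_fatou _ _ (fun m x => (l2_fun (u n) x - l2_fun (u (n + m)%N) x)
    ^+ 2 * w x)).
    move=> x; apply: cvgMl; rewrite expr2; under eq_fun do rewrite expr2.
    have c : l2_fun (u n) x - l2_fun (u (n + m)%N) x @[m --> \oo] --> l2_fun (u
      n) x - f x.
      apply: cvgB; first exact: cvg_cst.
      by have := uf x; rewrite -(cvg_shiftn n); under eq_fun do rewrite addnC.
    exact: (cvgM c c).
  move=> m; rewrite (@esum_tsum _ _ (fun x =>
    (l2_fun (u n) x - l2_fun (u (n + m)%N) x) ^+ 2 * w x)).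
  - rewrite lee_fin -[X in X <= _](_ : nrm (u n - u (n + m)%N) ^+ 2 = _).
      by rewrite ler_sqr ?nnegrE ?nrm_ge0// ub// leq_addr.
    by rewrite (sqr_nrm l2_ipP) l2_ip_sqr.
  - by move=> x; rewrite mulr_ge0 ?sqr_ge0 ?(ltW (w_gt0 x)).
  - exact: (l2_sqr_summable (u n - u (n + m)%N)).
have pos n x : 0 <= (l2_fun (u n) x - f x) ^+ 2 * w x.
  by rewrite mulr_ge0 ?sqr_ge0 ?(ltW (w_gt0 x)).
have diff_summ n : sqr_summable (fun x => l2_fun (u n) x - f x).
  rewrite /sqr_summable /abs_summable; under eq_esum do rewrite ger0_norm//.
  by apply: le_lt_trans (bound n) _; rewrite ltry.
have sf : sqr_summable f.
  have := sqr_summable_linear (-1) (diff_summ 0%N) (l2_sqr_summable (u 0%N)).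
  by congr sqr_summable; apply: funext => x; ring.
exists (MkL2 (asboolT sf : (f : V -> R^o) \in l2_pred)) => n.
rewrite -ler_sqr ?nnegrE ?nrm_ge0// (sqr_nrm l2_ipP) l2_ip_sqr.
rewrite -lee_fin -esum_tsum; [exact: bound|exact: pos|exact: diff_summ].
Qed.

End L2Space.

(** * Reversible Markov kernels *)

(** A random walk with finitely many possible steps, reversible with respect
    to the weights w. The list r x contains the possible successors of x. *)
Record reversible_kernel (R : realType) (V : choiceType) (w : V -> R)
    (q : V -> V -> R) (r : V -> seq V) := ReversibleKernel {
  kernel_uniq : forall x, uniq (r x) ;
  kernel_out : forall x y, y \notin r x -> q x y = 0 ;
  kernel_ge0 : forall x y, 0 <= q x y ;
  kernel_sum1 : forall x, \sum_(y <- r x) q x y = 1 ;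
  kernel_rev : forall x y, w x * q x y = w y * q y x }.

Section Kernel.
Context {R : realType} {V : choiceType} (w : V -> R).
Context (q : V -> V -> R) (r : V -> seq V) (qP : reversible_kernel w q r).
Hypothesis w_gt0 : forall x, 0 < w x.
Implicit Types (f g h : V -> R).

Let w_ge0 x : 0 <= w x := ltW (w_gt0 x).
Let q_ge0 := kernel_ge0 qP.

Definition avg f x := \sum_(y <- r x) q x y * f y.

Lemma avg_linear a f g x : avg (fun y =>
  a * f y + g y) x = a * avg f x + avg g x.
Proof.
rewrite /avg big_distrr -big_split/=; apply: eq_bigr => y _; ring.
Qed.

Lemma avgD f g x : avg (fun y => f y + g y) x = avg f x + avg g x.
Proof. by rewrite /avg -big_split/=; apply: eq_bigr => y _; rewrite mulrDr. Qed.

Lemma avgB f g x : avg (fun y => f y - g y) x = avg f x - avg g x.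
Proof. by rewrite /avg -sumrB; apply: eq_bigr => y _; rewrite mulrBr. Qed.

Lemma avgZ a f x : avg (fun y => a * f y) x = a * avg f x.
Proof. by rewrite /avg big_distrr; apply: eq_bigr => y _ /=;
  rewrite mulrCA. Qed.

Lemma avg_cst c x : avg (fun=> c) x = c.
Proof. by rewrite /avg -big_distrl/= (kernel_sum1 qP) mul1r. Qed.

Lemma le_avg f g x : (forall y, f y <= g y) -> avg f x <= avg g x.
Proof. by move=> fg; apply: ler_sum => y _; rewrite ler_wpM2l. Qed.

Lemma avg_ge0 f x : (forall y, 0 <= f y) -> 0 <= avg f x.
Proof. by move=> f0; apply: sumr_ge0 => y _; rewrite mulr_ge0. Qed.

Lemma norm_avg f x : `|avg f x| <= avg (fun y => `|f y|) x.
Proof.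
rewrite (le_trans (ler_norm_sum _ _ _))//; apply: ler_sum => y _.
by rewrite normrM ger0_norm.
Qed.

(** Convexity enters through the line of support at each point. *)
Lemma avg_jensen (psi : R -> R) f x :
  (forall s, exists k, forall u, psi s + k * (u - s) <= psi u) ->
  psi (avg f x) <= avg (fun y => psi (f y)) x.
Proof.
move=> tangent; have [k kP] := tangent (avg f x).
apply: le_trans (le_avg x (fun y => kP (f y))).
rewrite avgD avg_cst avgZ avgB avg_cst subrr mulr0 addr0//.
Qed.

Lemma avg_sqr f x : avg f x ^+ 2 <= avg (fun y => f y ^+ 2) x.
Proof.
apply: (avg_jensen (psi := fun s => s ^+ 2)) => s; exists (2 * s) => u.
by have := sqr_ge0 (u - s); lra.
Qed.

(** Reversibility makes w an invariant measure. *)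
Lemma esum_avg h : (forall x, 0 <= h x) ->
  (\esum_(x in [set: V]) (avg h x * w x)%:E =
   \esum_(x in [set: V]) (h x * w x)%:E)%E.
Proof.
move=> h0.
pose a x y := (w x * q x y * h y)%:E.
have a0 x y : (0 <= a x y)%E by rewrite lee_fin !mulr_ge0.
transitivity (\esum_(x in [set: V]) \esum_(y in [set: V]) a x y)%E.
  apply: eq_esum => x _; rewrite (esum_seq (kernel_uniq qP x))//; last first.
    by move=> y /(kernel_out qP) q0; rewrite /a q0 mulr0 mul0r.
  rewrite sumEFin; congr EFin; rewrite mulrC big_distrr.
  by apply: eq_bigr => y _ /=; rewrite mulrA.
rewrite esum_exchange//; apply: eq_esum => y _.
rewrite (esum_seq (kernel_uniq qP y))//; last first.
  by move=> x /(kernel_out qP) q0; rewrite /a (kernel_rev qP) q0 mulr0 mul0r.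
rewrite sumEFin; congr EFin.
rewrite (eq_bigr (fun x => h y * w y * q y x)); last first.
  by move=> x _; rewrite (kernel_rev qP); ring.
by rewrite -big_distrr/= (kernel_sum1 qP) mulr1.
Qed.

Lemma abs_summable_avg h : abs_summable (fun x => h x * w x) ->
  abs_summable (fun x => avg h x * w x).
Proof.
move=> sh; have sh' : abs_summable (fun x => `|h x| * w x).
  by apply: abs_summable_le sh => x; rewrite !normrM normr_id.
rewrite /abs_summable.
apply: (@le_lt_trans _ _ (\esum_(x in [set: V]) (avg (fun y =>
  `|h y|) x * w x)%:E)%E).
  apply: le_esum => x _; rewrite lee_fin normrM (ger0_norm (w_ge0 x)).
  by rewrite ler_wpM2r// norm_avg.
rewrite esum_avg//; move: sh'; rewrite /abs_summable.
by under eq_esum do rewrite normrM normr_id (ger0_norm (w_ge0 _)).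
Qed.

Lemma tsum_avg h : abs_summable (fun x => h x * w x) ->
  tsum (fun x => avg h x * w x) = tsum (fun x => h x * w x).
Proof.
have ge0 a : (forall x, 0 <= a x) -> tsum (fun x =>
  avg a x * w x) = tsum (fun x => a x * w x).
  move=> a0; rewrite !tsum_ge0E ?esum_avg// => x; rewrite mulr_ge0//.
  exact: avg_ge0.
move=> sh.
have hE x : h x = h^\+ x - h^\- x.
  by rewrite /funrpos /funrneg /Num.max; case: ifP => ?; case: ifP => ?; lra.
have sp : abs_summable (fun x => h^\+ x * w x).
  apply: abs_summable_le sh => x; rewrite !normrM ler_wpM2r//.
  rewrite /funrpos; rewrite ger0_norm ?le_max ?lexx ?orbT//.
  by rewrite ge_max ler_norm normr_ge0.
have sn : abs_summable (fun x => h^\- x * w x).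
  apply: abs_summable_le sh => x; rewrite !normrM ler_wpM2r//.
  rewrite /funrneg; rewrite ger0_norm ?le_max ?lexx ?orbT//.
  by rewrite ge_max normr_ge0 andbT -normrN ler_norm.
transitivity (tsum (fun x => avg h^\+ x * w x - avg h^\- x * w x)).
  congr tsum; apply: funext => x; rewrite -mulrBl -avgB; congr (_ * _).
  by congr avg; apply: funext => y; rewrite -hE.
rewrite (tsumB (abs_summable_avg sp) (abs_summable_avg sn)).
rewrite !ge0 => [||x]; [|exact: funrneg_ge0|exact: funrpos_ge0].
rewrite -(tsumB sp sn); congr tsum; apply: funext => x.
by rewrite -mulrBl -hE.
Qed.

Lemma sqr_summable_avg f : sqr_summable w f -> sqr_summable w (avg f).
Proof.
move=> /abs_summable_avg; apply: abs_summable_le => x.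
have a0 : 0 <= avg (fun y => f y ^+ 2) x by apply: avg_ge0 => y; exact: sqr_ge0.
rewrite (normrM (avg f x ^+ 2)) (normrM (avg (fun y =>
  f y ^+ 2) x)) ler_wpM2r//.
by rewrite (ger0_norm a0) ger0_norm ?sqr_ge0// avg_sqr.
Qed.

Definition avg_l2 (u : L2 w) : L2 w :=
  MkL2 (asboolT (sqr_summable_avg (l2_sqr_summable u)) : (avg (l2_fun u) : V ->
    R^o) \in l2_pred w).

Lemma avg_l2_linear : linear avg_l2.
Proof.
move=> a u v; apply: l2_ext => x; rewrite l2_funD l2_funZ.
by rewrite /avg_l2 [LHS]avg_linear.
Qed.

Local Notation dot := (l2_ip (w := w)).
Let dotP := l2_ipP w_gt0.
Let dotE := formE dotP.

Lemma avg_l2_contract u : dot (avg_l2 u) (avg_l2 u) <= dot u u.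
Proof.
rewrite !l2_ip_sqr -[leRHS]tsum_avg; last exact: l2_sqr_summable.
apply: le_tsum => [|| x]; [exact: (l2_sqr_summable (avg_l2 u))| |].
  exact/abs_summable_avg/l2_sqr_summable.
by rewrite ler_wpM2r// avg_sqr.
Qed.

Let avg_l2_sym_ge0 (u v : L2 w) : (forall x, 0 <= l2_fun u x) ->
  (forall x, 0 <= l2_fun v x) -> dot (avg_l2 u) v = dot u (avg_l2 v).
Proof.
move=> u0 v0; rewrite /l2_ip !tsum_ge0E; last 2 first.
- by move=> x; rewrite !mulr_ge0// avg_ge0.
- by move=> x; rewrite !mulr_ge0// avg_ge0.
congr fine.
pose a x y := (w x * q x y * l2_fun u y * l2_fun v x)%:E.
have a0 x y : (0 <= a x y)%E by rewrite lee_fin !mulr_ge0.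
transitivity (\esum_(x in [set: V]) \esum_(y in [set: V]) a x y)%E.
  apply: eq_esum => x _; rewrite (esum_seq (kernel_uniq qP x))//; last first.
    by move=> y /(kernel_out qP) q0; rewrite /a q0 mulr0 !mul0r.
  rewrite sumEFin; congr EFin; rewrite /= /avg -mulrA mulrC big_distrr/=.
  by apply: eq_bigr => y _ /=; ring.
rewrite esum_exchange//; apply: eq_esum => y _.
rewrite (esum_seq (kernel_uniq qP y))//; last first.
  by move=> x /(kernel_out qP) q0; rewrite /a (kernel_rev qP) q0 mulr0 !mul0r.
rewrite sumEFin; congr EFin; rewrite /= /avg mulrAC big_distrr/=.
by apply: eq_bigr => x _ /=; rewrite (kernel_rev qP); ring.
Qed.

Lemma sqr_summable_le f g : (forall x, `|f x| <= `|g x|) ->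
  sqr_summable w g -> sqr_summable w f.
Proof.
move=> fg; apply: abs_summable_le => x.
rewrite (normrM (f x ^+ 2)) (normrM (g x ^+ 2)) ler_wpM2r// !normrX.
by rewrite ler_pXn2r ?nnegrE.
Qed.

Lemma sqr_summable_pos f : sqr_summable w f -> sqr_summable w f^\+.
Proof.
apply: sqr_summable_le => x; rewrite ger0_norm ?le_max ?lexx ?orbT//.
by rewrite ge_max ler_norm normr_ge0.
Qed.

Lemma sqr_summable_neg f : sqr_summable w f -> sqr_summable w f^\-.
Proof.
apply: sqr_summable_le => x; rewrite ger0_norm ?le_max ?lexx ?orbT//.
by rewrite ge_max normr_ge0 andbT -normrN ler_norm.
Qed.

Lemma avg_l2_sym : symmetric_op dot avg_l2.
Proof.
(* Tonelli handles nonnegative functions; bilinearity does the rest. *)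
have split (u : L2 w) : exists p n : L2 w, [/\ u = p - n, forall x,
  0 <= l2_fun p x &
                               forall x, 0 <= l2_fun n x].
  have sp := sqr_summable_pos (l2_sqr_summable u).
  have sn := sqr_summable_neg (l2_sqr_summable u).
  exists (MkL2 (asboolT sp : ((l2_fun u)^\+ : V -> R^o) \in l2_pred w)).
  exists (MkL2 (asboolT sn : ((l2_fun u)^\- : V -> R^o) \in l2_pred w)).
  split=> [|x|x]; [|exact: funrpos_ge0|exact: funrneg_ge0].
  apply: l2_ext => x; rewrite l2_funB/= /funrpos /funrneg /Num.max.
  by case: ifP => ?; case: ifP => ?; lra.
move=> u v; have [p [n [-> p0 n0]]] := split u.
have [p' [n' [-> p'0 n'0]]] := split v.
rewrite !(lin_sub avg_l2_linear) !dotE.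
rewrite !avg_l2_sym_ge0 ?p0 ?n0 ?p'0 ?n'0//; ring.
Qed.

Definition diff_l2 (u : L2 w) := u - avg_l2 u.

Lemma diff_l2_sym : symmetric_op dot diff_l2.
Proof. by move=> u v; rewrite /diff_l2 !dotE avg_l2_sym. Qed.

(** Twice the carre du champ of the walk. *)
Definition energy f g x := avg (fun y => (f y - f x) * (g y - g x)) x.

Lemma energyE f g x : energy f g x =
  avg (fun y => f y * g y) x - f x * avg g x - avg f x * g x + f x * g x.
Proof.
rewrite /energy -[f x * g x](avg_cst _ x) (mulrC (avg f x)) -!avgZ -!avgB -avgD.
by congr avg; apply: funext => y; ring.
Qed.

(** The discrete Green formula: the averages of the four terms of the product
    are given by the invariance of w and the symmetry of averaging. *)
Lemma energy_l2 (u v : L2 w) :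
  abs_summable (fun x => energy (l2_fun u) (l2_fun v) x * w x) /\
  tsum (fun x => energy (l2_fun u) (l2_fun v) x * w x) = 2 * dot (diff_l2 u) v.
Proof.
have sP (a b : L2 w) := sqr_summable_prod (l2_sqr_summable a) (l2_sqr_summable
  b).
have E : (fun x => energy (l2_fun u) (l2_fun v) x * w x) =
  (fun x => ((avg (fun y => l2_fun u y * l2_fun v y) x * w x
  - l2_fun u x * l2_fun (avg_l2 v) x * w x)
  - l2_fun (avg_l2 u) x * l2_fun v x * w x) + l2_fun u x * l2_fun v x * w x).
  by apply: funext => x; rewrite energyE/=; ring.
have s1 := abs_summable_avg (sP u v).
have s2 := abs_summableB s1 (sP u (avg_l2 v)).
have s3 := abs_summableB s2 (sP (avg_l2 u) v).
rewrite E; split; first exact: abs_summableD.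
rewrite (tsumD s3 (sP u v)) (tsumB s2 (sP (avg_l2 u) v)) (tsumB s1 (sP u
  (avg_l2 v))).
rewrite (tsum_avg (sP u v)) -!/(l2_ip _ _) /diff_l2 !dotE avg_l2_sym.
by ring.
Qed.

Lemma diff_l2_ge0 u : 0 <= dot (diff_l2 u) u.
Proof.
have [_ E] := energy_l2 u u.
have : 0 <= 2 * dot (diff_l2 u) u.
  rewrite -E; apply: tsum_ge0 => x; rewrite mulr_ge0// avg_ge0// => y.
  by rewrite -expr2 sqr_ge0.
by rewrite pmulr_rge0.
Qed.

Hypothesis lazy : forall x, 1 / 2 <= q x x.

Let q_diag x : x \in r x.
Proof.
apply: contraT => /(kernel_out qP) q0; have := lazy x; rewrite q0; lra.
Qed.

Lemma energy_lazy f x : energy f f x <= 2 * avg (fun y => f y ^+ 2) x.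
Proof.
(* The term y = x of the average of (f y + f x)^2 is at least 2 (f x)^2. *)
have diag : q x x * (f x + f x) ^+ 2 <= avg (fun y => (f y + f x) ^+ 2) x.
  rewrite /avg (bigD1_seq x)/= ?q_diag ?(kernel_uniq qP)// lerDl sumr_ge0// =>
    y _.
  by rewrite mulr_ge0 ?sqr_ge0.
have sumE : energy f f x + avg (fun y => (f y + f x) ^+ 2) x =
    2 * avg (fun y => f y ^+ 2) x + 2 * f x ^+ 2.
  rewrite /energy -avgD -[2 * f x ^+ 2](avg_cst _ x) -avgZ -avgD.
  by congr avg; apply: funext => y; ring.
have := ler_wpM2r (sqr_ge0 (f x + f x)) (lazy x); lra.
Qed.

(** For a lazy walk the averaging operator is nonnegative. *)
Lemma diff_l2_le1 u : dot (diff_l2 u) u <= dot u u.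
Proof.
have [s E] := energy_l2 u u.
have sA := abs_summable_avg (l2_sqr_summable u).
rewrite -(@ler_pM2l _ 2)// -E l2_ip_sqr -(tsum_avg (l2_sqr_summable u)).
rewrite -(tsumZ _ sA); apply: le_tsum => //; first exact: abs_summableZ.
by move=> x; rewrite mulrA ler_wpM2r// energy_lazy.
Qed.

End Kernel.

(** * Inequalities for real powers *)

Section SignedPower.
Context {R : realType}.
Implicit Types (a b s t u p e : R).

Lemma powR1l e : 1 `^ e = 1 :> R.
Proof. by rewrite powR1. Qed.

(** The signed power, with e = p - 1 the duality map of l^p and with e = p / 2
    the map that turns l^p norms into l^2 norms. *)
Definition spow (e t : R) : R := Num.sg t * `|t| `^ e.

Lemma spowN e t : spow e (- t) = - spow e t.
Proof. by rewrite /spow sgrN normrN mulNr. Qed.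

Lemma spow_ge0 e t : 0 <= t -> 0 < e -> spow e t = t `^ e.
Proof.
move=> t0 e0; rewrite /spow ger0_norm//.
move: t0; rewrite le_eqVlt => /predU1P[<-|t0].
  by rewrite sgr0 mul0r powR0// gt_eqF.
by rewrite gtr0_sg// mul1r.
Qed.

Lemma norm_spow e t : 0 < e -> `|spow e t| = `|t| `^ e.
Proof.
move=> e0; have [->|t0] := eqVneq t 0.
  by rewrite /spow sgr0 mul0r normr0 powR0// gt_eqF.
by rewrite /spow normrM normr_sg t0 mul1r ger0_norm ?powR_ge0.
Qed.

Lemma spow_sqr p t : 0 < p -> spow (p / 2) t ^+ 2 = `|t| `^ p.
Proof.
move=> p0; rewrite -real_normK ?num_real// norm_spow ?divr_gt0//.
by rewrite -powR_mulrn ?powR_ge0// -powRrM divfK// gt_eqF.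
Qed.

Lemma spow_mul p t : 1 < p -> t * spow (p - 1) t = `|t| `^ p.
Proof.
move=> p1; rewrite /spow mulrCA mulrA -normrEsg.
by rewrite mulr_powRB1// (lt_trans ltr01).
Qed.

Lemma young p u s : 1 < p ->
  `|u| * `|s| `^ (p - 1) <= p^-1 * `|u| `^ p + (1 - p^-1) * `|s| `^ p.
Proof.
move=> p1; have p0 : 0 < p by rewrite (lt_trans ltr01).
have pn0 : p != 0 by rewrite gt_eqF.
have p10 : 0 < p - 1 by rewrite subr_gt0.
have pn1 : p - 1 != 0 by rewrite gt_eqF.
have q0 : 0 < p / (p - 1) by rewrite divr_gt0.
have pq : p^-1 + (p / (p - 1))^-1 = 1 by rewrite invf_div; field; rewrite pn0.
have := conjugate_powR (normr_ge0 u) (powR_ge0 `|s| (p - 1)) p0 q0 pq.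
rewrite -powRrM (_ : (p - 1) * _ = p); last by field.
rewrite invf_div (_ : (p - 1) / p = 1 - p^-1); last by field; rewrite pn0.
by rewrite (mulrC p^-1) (mulrC (1 - p^-1)).
Qed.

Lemma young_spow p u s : 1 < p ->
  u * spow (p - 1) s <= p^-1 * `|u| `^ p + (1 - p^-1) * `|s| `^ p.
Proof.
move=> p1; apply: le_trans (young u s p1).
rewrite (le_trans (ler_norm _))// normrM norm_spow//.
by rewrite subr_gt0.
Qed.

Lemma young_eps p (eps : R) : 1 < p -> 0 < eps -> exists2 C, 0 < C &
  forall u s, `|u| * `|s| `^ (p - 1) <= C * `|u| `^ p + eps * `|s| `^ p.
Proof.
move=> p1 e0; have p0 : 0 < p by rewrite (lt_trans ltr01).
have pn0 : p != 0 by rewrite gt_eqF.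
have p10 : 0 < p - 1 by rewrite subr_gt0.
have pn1 : p - 1 != 0 by rewrite gt_eqF.
(* Young's inequality for l^-1 |u| and l |s|^(p-1); l^(p/(p-1)) = eps. *)
pose l := eps `^ ((p - 1) / p).
have l0 : 0 < l by rewrite powR_gt0.
have ll : l `^ (p / (p - 1)) = eps.
  rewrite -powRrM (_ : _ * _ = 1); first by rewrite powRr1// ltW.
  by field; rewrite pn0 pn1.
exists (l^-1 `^ p); first by rewrite powR_gt0// invr_gt0.
move=> u s.
have q0 : 0 < p / (p - 1) by rewrite divr_gt0.
have pq : p^-1 + (p / (p - 1))^-1 = 1 by rewrite invf_div; field; rewrite pn0.
have ge1 : 0 <= l^-1 * `|u| by rewrite mulr_ge0// invr_ge0 ltW.
have ge2 : 0 <= l * `|s| `^ (p - 1) by rewrite mulr_ge0 ?powR_ge0// ltW.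
have := conjugate_powR ge1 ge2 p0 q0 pq.
rewrite mulrACA mulVf ?gt_eqF// mul1r => /le_trans; apply.
rewrite !powRM ?powR_ge0 ?invr_ge0 ?(ltW l0)// ll -powRrM.
rewrite (_ : (p - 1) * _ = p); last by field.
apply: lerD; rewrite ler_piMr ?mulr_ge0 ?powR_ge0 ?(ltW e0)//.
  by rewrite invf_le1// ltW.
by rewrite invf_div ler_pdivrMr// mul1r lerBlDr lerDl.
Qed.

(** The line of support of |t|^p is Young's inequality in disguise. *)
Lemma norm_powR_tangent p s : 1 < p ->
  forall u, `|s| `^ p + p * spow (p - 1) s * (u - s) <= `|u| `^ p.
Proof.
move=> p1 u.
have p0 : 0 < p by rewrite (lt_trans ltr01).
have Y := ler_wpM2l (ltW p0) (young_spow u s p1).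
have YE : p * (p^-1 * `|u| `^ p + (1 - p^-1) * `|s| `^ p) =
    `|u| `^ p + (p - 1) * `|s| `^ p by field; rewrite gt_eqF.
have -> : p * spow (p - 1) s * (u - s) =
    p * (u * spow (p - 1) s) - p * `|s| `^ p by rewrite -(spow_mul s p1); ring.
by rewrite YE in Y; lra.
Qed.

Lemma powR_normD p a b : 0 < p ->
  `|a + b| `^ p <= 2 `^ p * (`|a| `^ p + `|b| `^ p).
Proof.
move=> p0.
wlog ab : a b / `|a| <= `|b|.
  move=> H; have [/H//|/ltW/H] := leP `|a| `|b|.
  by rewrite (addrC b) (addrC (`|b| `^ p)).
apply: (@le_trans _ _ (2 `^ p * `|b| `^ p)).
  rewrite -powRM// ge0_ler_powR ?nnegrE ?mulr_ge0//; first exact: ltW.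
  by rewrite (le_trans (ler_normD _ _))// mulr_natl mulr2n lerD2r.
by rewrite ler_wpM2l ?powR_ge0// lerDr powR_ge0.
Qed.

Lemma powR_normB p a b : 0 < p ->
  `|a - b| `^ p <= 2 `^ p * (`|a| `^ p + `|b| `^ p).
Proof. by move=> p0; rewrite -(normrN b) powR_normD. Qed.

(** Bernoulli's inequality when e > 1, else monotonicity in the exponent. *)
Lemma onem_powR_le t e : 0 <= t <= 1 -> 0 < e ->
  1 - t `^ e <= (1 + e) * (1 - t).
Proof.
move=> /andP[t0 t1] e0; have d0 : 0 <= 1 - t by rewrite subr_ge0.
have ed : 0 <= e * (1 - t) by rewrite mulr_ge0// ltW.
have [e1|e1] := ltP 1 e.
  have := norm_powR_tangent 1 e1 t.
  rewrite spow_ge0 ?subr_gt0// normr1 !powR1l mulr1 (ger0_norm t0); lra.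
move: t0; rewrite le_eqVlt => /predU1P[<-|t0].
  by rewrite powR0 ?gt_eqF// !subr0 mulr1 lerDl ltW.
have t01 : 0 < t <= 1 by rewrite t0.
by have := ger1_powR t01 e1; lra.
Qed.

(** The previous inequality, for t^e and the exponent 1 / e. *)
Lemma onem_le_powR t e : 0 <= t <= 1 -> 0 < e ->
  1 - t <= (1 + e^-1) * (1 - t `^ e).
Proof.
move=> /andP[t0 t1] e0.
have -> : 1 - t = 1 - (t `^ e) `^ e^-1.
  by rewrite -powRrM mulfV ?gt_eqF// powRr1.
apply: onem_powR_le; rewrite ?invr_gt0// powR_ge0/=.
by rewrite -[leRHS](powR1l e) ge0_ler_powR// ?nnegrE// ltW.
Qed.

(** The Stroock-Varopoulos inequality, with a constant that is not sharp. It
    compares the l^2 energy of |f|^(p/2) sgn f with the pairing of D f with the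
    dual function |f|^(p-1) sgn f. *)
Lemma spow_sqr_diff p a b : 1 < p ->
  (spow (p / 2) a - spow (p / 2) b) ^+ 2 <=
  (2 + (1 + p / 2) ^+ 2 * (1 + (p - 1)^-1)) *
    ((a - b) * (spow (p - 1) a - spow (p - 1) b)).
Proof.
move=> p1; set C := (2 + (1 + p / 2) ^+ 2 * (1 + (p - 1)^-1)).
have p0 : 0 < p by rewrite (lt_trans ltr01).
have p10 : 0 < p - 1 by rewrite subr_gt0.
have h0 : 0 < p / 2 by rewrite divr_gt0.
have C'0 : 0 <= (1 + p / 2) ^+ 2 * (1 + (p - 1)^-1).
  by rewrite mulr_ge0 ?sqr_ge0// addr_ge0// invr_ge0 ltW.
wlog ab : a b / b <= a.
  move=> H; have [/H//|/ltW/H] := leP b a.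
  have -> : forall x y : R, (x - y) ^+ 2 = (y - x) ^+ 2 by move=> x y; ring.
  by congr (_ <= _ * _); ring.
(* For 0 <= y <= x, homogeneity reduces the claim to t = y / x in [0, 1], where
   both sides are comparable to (1 - t)^2. *)
have pos x y : 0 <= y -> y <= x ->
    (spow (p / 2) x - spow (p / 2) y) ^+ 2 <=
    C * ((x - y) * (spow (p - 1) x - spow (p - 1) y)).
  move=> y0 yx; have x0 := le_trans y0 yx; rewrite !spow_ge0//.
  move: x0; rewrite le_eqVlt => /predU1P[xe|x0].
    have ye : y = 0 by apply/eqP; rewrite eq_le y0 xe yx.
    by rewrite -xe ye !subrr mul0r mulr0 expr0n.
  have [t tE] : exists t, t = y / x by exists (y / x).
  have yE : y = t * x by rewrite tE divfK// gt_eqF.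
  have t0 : 0 <= t by rewrite tE divr_ge0// ltW.
  have t1 : t <= 1 by rewrite tE ler_pdivrMr// mul1r.
  have t01 : 0 <= t <= 1 by rewrite t0.
  have xx0 := ltW x0.
  rewrite yE !powRM//.
  have u1 := onem_powR_le t01 h0; have u2 := onem_le_powR t01 p10.
  have l1 : 0 <= 1 - t by rewrite subr_ge0.
  have l2 : 0 <= 1 - t `^ (p / 2).
    by rewrite subr_ge0 -[leRHS](powR1l (p / 2)) ge0_ler_powR// ?nnegrE// ltW.
  have l3 : 0 <= 1 - t `^ (p - 1).
    by rewrite subr_ge0 -[leRHS](powR1l (p - 1)) ge0_ler_powR// ?nnegrE// ltW.
  have -> : (x `^ (p / 2) - t `^ (p / 2) * x `^ (p / 2)) ^+ 2 =
      (1 - t `^ (p / 2)) ^+ 2 * x `^ p.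
    rewrite -[in RHS](_ : (x `^ (p / 2)) ^+ 2 = x `^ p); first by ring.
    by rewrite -powR_mulrn ?powR_ge0// -powRrM divfK.
  have -> : (x - t * x) * (x `^ (p - 1) - t `^ (p - 1) * x `^ (p - 1)) =
      (1 - t) * (1 - t `^ (p - 1)) * x `^ p.
    by rewrite -(mulr_powRB1 xx0 p0); ring.
  rewrite mulrA ler_wpM2r ?powR_ge0//.
  have e1 : (1 - t `^ (p / 2)) ^+ 2 <= ((1 + p / 2) * (1 - t)) ^+ 2.
    have m0 : 0 <= (1 + p / 2) * (1 - t) by rewrite mulr_ge0// addr_ge0// ltW.
    by rewrite ler_sqr ?nnegrE.
  have e2 : (1 - t) ^+ 2 <= (1 - t) * ((1 + (p - 1)^-1) * (1 - t `^ (p - 1))).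
    by rewrite expr2 ler_wpM2l.
  have e3 := ler_wpM2l (sqr_ge0 (1 + p / 2)) e2.
  have e4 : 0 <= (1 - t) * (1 - t `^ (p - 1)) by rewrite mulr_ge0.
  rewrite exprMn in e1.
  by rewrite /C mulrDl; lra.
have [b0|b0] := leP 0 b; first exact: pos.
have [a0|a0] := leP a 0.
  have := pos (- b) (- a); rewrite oppr_ge0 lerN2 !spowN => /(_ a0 ab).
  by congr (_ <= _); ring.
have [c bE] : exists c, b = - c by exists (- b); rewrite opprK.
have c0 : 0 < c by rewrite -oppr_lt0 -bE.
rewrite bE !spowN !opprK !spow_ge0 ?(ltW a0) ?(ltW c0)//.
set A := a `^ (p / 2); set B := c `^ (p / 2).
have sqrE (x : R) : 0 < x -> (x `^ (p / 2)) ^+ 2 = x * x `^ (p - 1).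
  by move=> /ltW x0; rewrite -powR_mulrn ?powR_ge0// -powRrM divfK//
    mulr_powRB1.
have A2 := sqrE a a0; have B2 := sqrE c c0; rewrite -/A in A2;
  rewrite -/B in B2.
have m1 : 0 <= a * c `^ (p - 1) by rewrite mulr_ge0 ?powR_ge0 ?ltW.
have m2 : 0 <= c * a `^ (p - 1) by rewrite mulr_ge0 ?powR_ge0 ?ltW.
have m3 : 0 <= (a + c) * (a `^ (p - 1) + c `^ (p - 1)).
  by rewrite mulr_ge0 ?addr_ge0 ?powR_ge0 ?ltW.
apply: (@le_trans _ _ (2 * ((a + c) * (a `^ (p - 1) + c `^ (p - 1))))).
  by have := sqr_ge0 (A - B); lra.
by rewrite ler_wpM2r// /C lerDl.
Qed.

Lemma spow_continuous e : 0 < e -> continuous (spow e).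
Proof.
move=> e0 t; have [->|t0] := eqVneq t 0.
  apply/cvgrPdist_lt => eps eps0.
  have spow0 : spow e 0 = 0 by rewrite /spow sgr0 mul0r.
  near=> s; rewrite spow0 sub0r normrN norm_spow//.
  have es : `|s| < eps `^ e^-1.
    near: s; have := @nbhsx_ballx R R 0 _ (powR_gt0 e^-1 eps0).
    by apply: filterS => s; rewrite /ball/= sub0r normrN.
  apply: lt_le_trans (gt0_ltr_powR e0 _ _ es) _; rewrite ?nnegrE ?powR_ge0//.
  by rewrite -powRrM mulVf ?gt_eqF// powRr1// ltW.
have nz : \forall s \near t, s != 0 /\ Num.sg s = Num.sg t.
  have [tp|tn|tz] := ltrgt0P t; last by rewrite tz eqxx in t0.
    near=> s; have sp : 0 < s by near: s; exact: lt_nbhsr.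
    by rewrite gt_eqF// !gtr0_sg.
  near=> s; have sp : s < 0 by near: s; exact: lt_nbhsl.
  by rewrite lt_eqF// !ltr0_sg.
apply: (@cvg_trans _ ((Num.sg t * expR (e * ln `|s|)) @[s --> t])).
  apply: near_eq_cvg; near=> s.
  have [s0 ss] : s != 0 /\ Num.sg s = Num.sg t by near: s.
  by rewrite /spow ss /powR normr_eq0 (negbTE s0).
have -> : spow e t = Num.sg t * expR (e * ln `|t|).
  by rewrite /spow /powR normr_eq0 (negbTE t0).
have c1 : `|s| @[s --> t] --> `|t| by exact: norm_continuous.
have c2 : ln `|s| @[s --> t] --> ln `|t|.
  by apply: continuous_cvg c1; apply: continuous_ln; rewrite normr_gt0.
have c3 : expR (e * ln `|s|) @[s --> t] --> expR (e * ln `|t|).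
  by apply: continuous_cvg; [exact: continuous_expR|apply: cvgM;
    [exact: cvg_cst|]].
exact: (cvgM (cvg_cst (Num.sg t)) c3).
Unshelve. all: by end_near. Qed.

End SignedPower.

(** * Coercivity in l^p of a walk of finite volume *)

Section LpTheory.
Context {R : realType} {V : choiceType} (w : V -> R).
Context (q : V -> V -> R) (r : V -> seq V) (qP : reversible_kernel w q r).
Hypotheses (w_gt0 : forall x, 0 < w x) (w_fin : abs_summable w).
Implicit Types (f g h : V -> R) (p : R).

Let w_ge0 x : 0 <= w x := ltW (w_gt0 x).
Let q_ge0 := kernel_ge0 qP.
Local Notation avg := (avg q r).
Local Notation energy := (energy q r).
Local Notation dot := (l2_ip (w := w)).
Local Notation P := (avg_l2 qP w_gt0).
Local Notation D := (diff_l2 qP w_gt0).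
Let dotP := l2_ipP w_gt0.
Let dotE := formE dotP.

Definition integ h := tsum (fun x => h x * w x).
Definition weighted_summable h := abs_summable (fun x => h x * w x).
Definition has_bound f := exists B, forall x, `|f x| <= B.

Lemma has_bound_summable f : has_bound f -> weighted_summable f.
Proof.
move=> [B fB]; apply: abs_summable_le (abs_summableZ B w_fin) => x.
rewrite !normrM ler_wpM2r//.
exact: le_trans (fB x) (ler_norm _).
Qed.

Lemma has_bound_comp (psi : R -> R) f : has_bound f ->
  (forall B, exists B', forall t, `|t| <= B -> `|psi t| <= B') ->
  has_bound (fun x => psi (f x)).
Proof.
by move=> [B fB] /(_ B)[B' psiB]; exists B' => x; apply: psiB.
Qed.

Lemma has_bound_sqr_summable f : has_bound f -> sqr_summable w f.
Proof.
move=> bf; apply: (@has_bound_summable (fun x => f x ^+ 2)).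
apply: (has_bound_comp (psi := fun t => t ^+ 2) bf) => B; exists (B ^+ 2) =>
  t tB.
by rewrite normrX ler_pXn2r ?nnegrE// (le_trans _ tB).
Qed.

Lemma has_bound_spow f e : 0 < e -> has_bound f -> has_bound (fun x =>
  spow e (f x)).
Proof.
move=> e0 bf; apply: (has_bound_comp bf) => B; exists (B `^ e) => t tB.
by rewrite norm_spow// ge0_ler_powR ?nnegrE ?(ltW e0)// (le_trans _ tB).
Qed.

Lemma has_bound_powR f e : 0 < e -> has_bound f -> has_bound (fun x =>
  `|f x| `^ e).
Proof.
move=> e0 /(has_bound_spow e0)[B fB]; exists B => x.
by rewrite ger0_norm ?powR_ge0// -norm_spow.
Qed.

Lemma has_boundB f c : has_bound f -> has_bound (fun x => f x - c).
Proof.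
move=> [B fB]; exists (B + `|c|) => x.
by rewrite (le_trans (ler_normB _ _))// lerD2r.
Qed.

Lemma weighted_summableD f g : weighted_summable f -> weighted_summable g ->
  weighted_summable (fun x => f x + g x).
Proof.
move=> sf sg; rewrite /weighted_summable; under eq_fun do rewrite mulrDl.
exact: abs_summableD.
Qed.

Lemma weighted_summableZ c f : weighted_summable f ->
  weighted_summable (fun x => c * f x).
Proof.
move=> sf; rewrite /weighted_summable; under eq_fun do rewrite -mulrA.
exact: abs_summableZ.
Qed.

Lemma integD f g : weighted_summable f -> weighted_summable g ->
  integ (fun x => f x + g x) = integ f + integ g.
Proof.
move=> sf sg; rewrite -(tsumD sf sg).
by congr tsum; apply: funext => x; rewrite mulrDl.
Qed.

Lemma integZ c f : weighted_summable f -> integ (fun x =>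
  c * f x) = c * integ f.
Proof.
move=> sf; rewrite -(tsumZ c sf).
by congr tsum; apply: funext => x; rewrite mulrA.
Qed.

Lemma le_integ f g : weighted_summable f -> weighted_summable g -> (forall x,
  f x <= g x) ->
  integ f <= integ g.
Proof. by move=> sf sg fg; apply: le_tsum => // x; rewrite ler_wpM2r. Qed.

Lemma integ_ge0 f : (forall x, 0 <= f x) -> 0 <= integ f.
Proof. by move=> f0; apply: tsum_ge0 => x; rewrite mulr_ge0. Qed.

Lemma integ_cst c : integ (fun=> c) = c * tsum w.
Proof. by rewrite -(tsumZ c w_fin). Qed.

Lemma weighted_summable_cst c : weighted_summable (fun=> c).
Proof. by apply: has_bound_summable; exists `|c|. Qed.

Lemma weighted_summable_le f g : (forall x, `|f x| <= g x) ->
  weighted_summable g -> weighted_summable f.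
Proof.
move=> fg; apply: abs_summable_le => x; rewrite !normrM ler_wpM2r//.
exact: le_trans (fg x) (ler_norm _).
Qed.

Definition l2_of f (bf : has_bound f) : L2 w :=
  MkL2 (asboolT (has_bound_sqr_summable bf) : (f : V -> R^o) \in l2_pred w).

Definition supported_in (f : V -> R) (s : seq V) :=
  uniq s /\ forall x, x \notin s -> f x = 0.

Lemma supported_in_bounded f s : supported_in f s -> has_bound f.
Proof.
move=> [us fs]; exists (\sum_(x <- s) `|f x|) => x.
have [xs|/fs->] := boolP (x \in s); last by rewrite normr0 sumr_ge0.
by rewrite (bigD1_seq x)//= lerDl sumr_ge0.
Qed.

Lemma integ_supported_in (psi : R -> R) f s : supported_in f s ->
  has_bound (fun x => psi (f x)) ->
  integ (fun x => psi (f x)) =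
  \sum_(x <- s) (psi (f x) - psi 0) * w x + psi 0 * tsum w.
Proof.
move=> [us fs] bpsi.
rewrite -integ_cst -(tsum_seq (f := fun x => (psi (f x) - psi 0) * w x) us);
  last first.
  by move=> x /fs->; rewrite subrr mul0r.
rewrite -[in RHS]/(integ (fun x => psi (f x) - psi 0)) -integD.
- by congr integ; apply: funext => x; rewrite subrK.
- exact/has_bound_summable/has_boundB.
- exact: weighted_summable_cst.
Qed.

(** The integral is nonnegative for m below all values of f and nonpositive for
    m above them; the intermediate value theorem applies. *)
Lemma signed_power_mean0 f s e : 0 < e -> supported_in f s ->
  exists m, integ (fun x => spow e (f x - m)) = 0.
Proof.
move=> e0 fs; have bf := supported_in_bounded fs.
have [B fB] := bf.
have bm m : has_bound (fun x => spow e (f x - m)).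
  exact/has_bound_spow/has_boundB.
(* F is a finite sum plus the contribution of the common value - m outside s,
   hence continuous. *)
pose F m := integ (fun x => spow e (f x - m)).
have B0 : - `|B| <= `|B| by rewrite ge0_cp.
have Fcont : continuous F.
  have -> : F = fun m => \sum_(x <- s) (spow e (f x - m) - spow e (0 - m)) * w x
                         + spow e (0 - m) * tsum w.
    by apply: funext => m; rewrite /F (integ_supported_in (psi := fun t =>
      spow e (t - m)) fs).
  have spow_sub c : continuous (fun m : R => spow e (c - m)).
    move=> m; apply: continuous_cvg; first exact: spow_continuous.
    by apply: cvgB; [exact: cvg_cst|exact: cvg_id].
  move=> m; apply: cvgD; last by apply: cvgM; [exact: spow_sub|exact: cvg_cst].
  elim: (s) => [|x s' IH].
    by under eq_fun do rewrite big_nil; rewrite big_nil; exact: cvg_cst.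
  under eq_fun do rewrite big_cons; rewrite big_cons; apply: cvgD => //.
  by apply: cvgM; [apply: cvgB; exact: spow_sub|exact: cvg_cst].
have Fl : 0 <= F (- `|B|).
  apply: integ_ge0 => x; have : 0 <= f x - - `|B|.
    by have := fB x; rewrite ler_norml opprK => /andP[H _];
      have := ler_norm B; lra.
  by move=> h; rewrite spow_ge0// powR_ge0.
have Fr : F `|B| <= 0.
  rewrite -oppr_ge0 -mulN1r -integZ; last exact/has_bound_summable/bm.
  apply: integ_ge0 => x; have : 0 <= - (f x - `|B|).
    by have := fB x; rewrite ler_norml => /andP[_ H]; have := ler_norm B; lra.
  by move=> h; rewrite mulN1r -spowN spow_ge0// powR_ge0.
have [|m _ Fm] := IVT B0 (continuous_subspaceT Fcont) (v := 0).
  apply/andP; split; first by rewrite ge_min; apply/orP; right; exact: Fr.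
  by rewrite le_max; apply/orP; left; exact: Fl.
by exists m.
Qed.

Hypothesis poincare : exists2 C, 0 < C & forall u : L2 w, exists c,
  integ (fun x => (l2_fun u x - c) ^+ 2) <= C * dot (D u) u.

Lemma weighted_summable_energy f g : has_bound f -> has_bound g ->
  weighted_summable (energy f g).
Proof. by move=> bf bg; have [] := energy_l2 qP w_gt0 (l2_of bf) (l2_of bg).
  Qed.

Lemma integ_energy f g (bf : has_bound f) (bg : has_bound g) :
  integ (energy f g) = 2 * dot (D (l2_of bf)) (l2_of bg).
Proof. by have [] := energy_l2 qP w_gt0 (l2_of bf) (l2_of bg). Qed.

(** The l^2 Poincare inequality for v = |f - m|^(p/2) sgn (f - m), whose squared
    norm is the p-th power of the l^p norm of f - m, combined with the
    Stroock-Varopoulos inequality. The constant m makes the mean of v vanish;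
    it need not be the mean of f, but the operators studied kill constants. *)
Lemma signed_power_poincare p : 1 < p -> exists2 c, 0 < c &
  forall f s, supported_in f s -> exists m,
    c * integ (fun x => `|f x - m| `^ p) <=
    integ (energy (fun x => f x - m) (fun x => spow (p - 1) (f x - m))).
Proof.
move=> p1; have p0 : 0 < p by rewrite (lt_trans ltr01).
have p10 : 0 < p - 1 by rewrite subr_gt0.
have h0 : 0 < p / 2 by rewrite divr_gt0.
have [C C0 CP] := poincare.
pose C' := (2 + (1 + p / 2) ^+ 2 * (1 + (p - 1)^-1)).
have C'0 : 0 < C'.
  by rewrite ltr_wpDr// mulr_ge0 ?sqr_ge0// addr_ge0// invr_ge0 ltW.
have arith (a b : R) : a <= C / 2 * (C' * b) -> 2 / (C * C') * a <= b.
  by move=> ab; rewrite mulrAC ler_pdivrMr ?mulr_gt0//; lra.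
exists (2 / (C * C')) => [|f s fs]; first by rewrite divr_gt0 ?mulr_gt0.
(* With this m, the mean of v is 0, so v is orthogonal to the constant c that
   the Poincare inequality provides, and |v - c| >= |v|. *)
have [m m0] := signed_power_mean0 h0 fs.
have bg := has_boundB m (supported_in_bounded fs).
have bv := has_bound_spow h0 bg; have bphi := has_bound_spow p10 bg.
exists m; set g := fun x => f x - m; set phi := fun x => spow (p - 1) (f x - m).
pose v := fun x => spow (p / 2) (f x - m).
have [c cP] := CP (l2_of bv).
have gv : integ (fun x => `|f x - m| `^ p) = integ (fun x => v x ^+ 2).
  by congr integ; apply: funext => x; rewrite spow_sqr.
have iv := has_bound_summable bv.
have iv2 := has_bound_sqr_summable bv.
have vc : integ (fun x => v x ^+ 2) <= integ (fun x => (v x - c) ^+ 2).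
  have -> : (fun x => (v x - c) ^+ 2) = fun x =>
    (v x ^+ 2 + (- (2 * c)) * v x) + c ^+ 2.
    by apply: funext => x; ring.
  rewrite integD; [|by apply: weighted_summableD => //;
    exact: weighted_summableZ|exact: weighted_summable_cst].
  rewrite (integD iv2 (weighted_summableZ _ iv)) (integZ _ iv).
  rewrite [integ v]m0 mulr0 addr0 lerDl.
  by apply: integ_ge0 => x; exact: sqr_ge0.
have ev : integ (energy v v) <= C' * integ (energy g phi).
  have ie := weighted_summable_energy bg bphi.
  rewrite -(integZ _ ie); apply: le_integ;
    first exact: weighted_summable_energy.
    exact: weighted_summableZ.
  move=> x; rewrite /energy -avgZ; apply: (le_avg qP) => y.
  by rewrite -expr2; apply: spow_sqr_diff.
have : integ (fun x => `|f x - m| `^ p) <= C / 2 * integ (energy v v).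
  rewrite gv; apply: (le_trans vc); apply: (le_trans cP).
  by rewrite (integ_energy bv bv) mulrA divfK.
move=> H; apply: arith; apply: (le_trans H).
by apply: ler_wpM2l ev; rewrite divr_ge0// ltW.
Qed.

Definition grad_pow p f x := avg (fun y => `|f y - f x| `^ p) x.

Lemma norm_powR_jensen p f x : 1 < p ->
  `|avg f x| `^ p <= avg (fun y => `|f y| `^ p) x.
Proof.
move=> p1; apply: (avg_jensen qP (psi := fun t => `|t| `^ p)) => s.
by exists (p * spow (p - 1) s) => u; exact: norm_powR_tangent.
Qed.

Lemma weighted_summable_avg h : weighted_summable h ->
  weighted_summable (avg h).
Proof. exact: abs_summable_avg. Qed.

Lemma integ_avg h : weighted_summable h -> integ (avg h) = integ h.
Proof. exact: tsum_avg. Qed.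

Lemma has_bound_grad_pow p f : 0 < p -> has_bound f -> has_bound (grad_pow p f).
Proof.
move=> p0 [B fB]; exists ((2 * B) `^ p) => x.
rewrite ger0_norm; last by apply: (avg_ge0 qP) => y; exact: powR_ge0.
rewrite -[leRHS](avg_cst qP _ x); apply: (le_avg qP) => y.
have B0 : 0 <= B by apply: le_trans (fB x).
rewrite ge0_ler_powR ?nnegrE ?mulr_ge0 ?(ltW p0)//.
by rewrite (le_trans (ler_normB _ _))// mulr_natl mulr2n lerD.
Qed.

Lemma grad_pow_shift p f c : grad_pow p (fun x => f x - c) = grad_pow p f.
Proof.
apply: funext => x; rewrite /grad_pow; congr avg; apply: funext => y.
by congr (`|_| `^ _); ring.
Qed.

Lemma integ_grad_pow_le p f c : 1 < p -> has_bound f ->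
  integ (grad_pow p f) <= 2 * 2 `^ p * integ (fun x => `|f x - c| `^ p).
Proof.
move=> p1 bf; have p0 : 0 < p by rewrite (lt_trans ltr01).
have bg := has_boundB c bf; pose g := fun x => f x - c.
have ig := has_bound_summable (has_bound_powR p0 bg).
have iag := weighted_summable_avg ig.
rewrite -(grad_pow_shift p f c).
have -> : 2 * 2 `^ p * integ (fun x => `|f x - c| `^ p) =
    integ (fun x => 2 `^ p * (avg (fun y => `|g y| `^ p) x + `|g x| `^ p)).
  rewrite (integZ _ (weighted_summableD iag ig)) (integD iag ig) (integ_avg ig).
  by rewrite /g; ring.
apply: le_integ; first exact/has_bound_summable/has_bound_grad_pow.
  exact/weighted_summableZ/weighted_summableD.
move=> x; rewrite -[X in _ * (_ + X)](avg_cst qP _ x) -avgD -avgZ.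
by apply: (le_avg qP) => y; exact: powR_normB.
Qed.

(** Among constants, the mean is optimal up to a factor for approximation in
    l^p, by Jensen's inequality. *)
Lemma mean_comparison p f m : 1 < p -> has_bound f -> 0 < tsum w ->
  integ (fun x => `|f x - (tsum w)^-1 * integ f| `^ p) <=
  2 * 2 `^ p * integ (fun x => `|f x - m| `^ p).
Proof.
move=> p1 bf N0; have p0 : 0 < p by rewrite (lt_trans ltr01).
set a := _ * integ f.
have ifm := has_bound_summable (has_bound_powR p0 (has_boundB m bf)).
have imean : integ (fun x => f x - m) = (a - m) * tsum w.
  rewrite (integD (has_bound_summable bf) (weighted_summable_cst (- m)))
    integ_cst.
  by rewrite /a; field; rewrite gt_eqF.
(* The tangent of |t|^p at the mean a - m integrates to its constant term. *)
have jensen : integ (fun=> `|m - a| `^ p) <= integ (fun x => `|f x - m| `^ p).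
  rewrite distrC; set k := p * spow (p - 1) (a - m).
  have i1 := weighted_summableZ k (has_bound_summable (has_boundB (a - m)
    (has_boundB m bf))).
  have i2 := weighted_summable_cst (`|a - m| `^ p).
  have -> : integ (fun=> `|a - m| `^ p) =
      integ (fun x => `|a - m| `^ p + k * ((f x - m) - (a - m))).
    rewrite (integD i2 i1) (integZ k (has_bound_summable (has_boundB _
      (has_boundB m bf)))).
    rewrite (integD (has_bound_summable (has_boundB m bf))
      (weighted_summable_cst (- (a - m)))).
    by rewrite imean !integ_cst mulNr subrr mulr0 addr0.
  apply: le_integ => //; first exact: weighted_summableD.
  by move=> x; exact: norm_powR_tangent.
have i3 := weighted_summable_cst (`|m - a| `^ p).
apply: (@le_trans _ _ (integ (fun x =>
  2 `^ p * (`|f x - m| `^ p + `|m - a| `^ p)))).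
  apply: le_integ; first exact/has_bound_summable/has_bound_powR/has_boundB.
    exact/weighted_summableZ/weighted_summableD.
  move=> x; have -> : f x - a = (f x - m) + (m - a) by ring.
  exact: powR_normD.
rewrite (integZ _ (weighted_summableD ifm i3)) (integD ifm i3) (mulrC 2) -mulrA.
by rewrite ler_wpM2l ?powR_ge0// mulr_natl mulr2n lerD2l.
Qed.

(** Young's inequality splits each product of increments; the second part will
    be absorbed by the left-hand side of the Poincare inequality. *)
Lemma integ_energy_le p (eps : R) : 1 < p -> 0 < eps -> exists2 C, 0 < C &
  forall g, has_bound g -> integ (energy g (fun x => spow (p - 1) (g x))) <=
    C * integ (grad_pow p g) + eps * integ (fun x => `|g x| `^ p).
Proof.
move=> p1 e0; have p0 : 0 < p by rewrite (lt_trans ltr01).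
have p10 : 0 < p - 1 by rewrite subr_gt0.
have e2 : 0 < eps / 2 by rewrite divr_gt0.
have [C C0 CP] := young_eps p1 e2.
exists (2 * C) => [|g bg]; first by rewrite mulr_gt0.
have ig := has_bound_summable (has_bound_powR p0 bg).
have iag := weighted_summable_avg ig.
have igp := has_bound_summable (has_bound_grad_pow p0 bg).
have -> : 2 * C * integ (grad_pow p g) + eps * integ (fun x => `|g x| `^ p) =
    integ (fun x => 2 * C * grad_pow p g x +
       eps / 2 * (avg (fun y => `|g y| `^ p) x + `|g x| `^ p)).
  rewrite (integD (weighted_summableZ _ igp) (weighted_summableZ _
    (weighted_summableD iag ig))).
  rewrite !(integZ _ igp) (integZ _ (weighted_summableD iag ig)) (integD iag
    ig).
  by rewrite (integ_avg ig); field.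
apply: le_integ.
- exact/(weighted_summable_energy bg)/has_bound_spow.
- by apply: weighted_summableD; apply: weighted_summableZ => //;
    exact: weighted_summableD.
move=> x; rewrite -[X in _ * (_ + X)](avg_cst qP _ x) -avgD /grad_pow -!avgZ
  -avgD.
apply: (le_avg qP) => y.
have H1 := CP (g y - g x) (g y); have H2 := CP (g y - g x) (g x).
apply: (@le_trans _ _ (`|g y - g x| * (`|g y| `^ (p - 1) + `|g x| `^ (p - 1)))).
  rewrite (le_trans (ler_norm _))// normrM ler_wpM2l//.
  by rewrite (le_trans (ler_normB _ _))// !norm_spow.
by rewrite mulrDr; lra.
Qed.

Lemma Lp_poincare p : 1 < p -> 0 < tsum w -> exists2 C, 0 < C &
  forall f s, supported_in f s ->
    integ (fun x => `|f x - (tsum w)^-1 * integ f| `^ p) <=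
    C * integ (grad_pow p f).
Proof.
move=> p1 N0; have p0 : 0 < p by rewrite (lt_trans ltr01).
have [c c0 cP] := signed_power_poincare p1.
have c2 : 0 < c / 2 by rewrite divr_gt0.
have [C C0 CP] := integ_energy_le p1 c2.
have arith (a b : R) : c * a <= C * b + c / 2 * a -> a <= 2 * C / c * b.
  by move=> ab; rewrite mulrAC ler_pdivlMr//; lra.
have K0 : 0 < 2 * 2 `^ p :> R by rewrite mulr_gt0// powR_gt0.
exists ((2 * 2 `^ p) * (2 * C / c));
  first by rewrite mulr_gt0// divr_gt0// mulr_gt0.
move=> f s fs; have bf := supported_in_bounded fs.
have [m mP] := cP f s fs; have bg := has_boundB m bf.
apply: le_trans (mean_comparison m p1 bf N0) _.
rewrite -[leRHS]mulrA ler_pM2l//.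
have := le_trans mP (CP _ bg); rewrite grad_pow_shift.
exact: arith.
Qed.

Section SquareRoot.
Variables (Q : L2 w -> L2 w) (kappa : R).
Hypotheses (Q_fix : forall u, Q u = 2^-1 *: (P u + Q (Q u)))
  (Q_sym : symmetric_op dot Q) (kappa_gt0 : 0 < kappa)
  (Q_convex : forall (X : L2 w -> Prop) u, convex_pred X ->
     closed_pred dot X -> X 0 -> (forall v, X v -> X (P v)) -> X u -> X (Q u)).

Let S u : L2 w := kappa *: (u - Q u).

Hypothesis (S_const : forall u c, (forall x, l2_fun u x = c) -> S u = 0).

Definition Lp_ball p B (u : L2 w) :=
  (\esum_(x in [set: V]) (`|l2_fun u x| `^ p * w x)%:E <= B%:E)%E.

Lemma Lp_ball_convex p B : 1 < p -> convex_pred (Lp_ball p B).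
Proof.
move=> p1 u v t /andP[t0 t1] uB vB.
have t1' : 0 <= 1 - t by rewrite subr_ge0.
have pw z x : 0 <= `|l2_fun z x| `^ p * w x by rewrite mulr_ge0 ?powR_ge0.
apply: (@le_trans _ _ (\esum_(x in [set: V])
    ((t * (`|l2_fun u x| `^ p * w x))%:E + ((1 - t) * (`|l2_fun v x| `^ p * w
      x))%:E))%E).
  apply: le_esum => x _; rewrite -EFinD lee_fin !mulrA -mulrDl ler_wpM2r//.
  rewrite l2_funD !l2_funZ; set a := l2_fun u x; set b := l2_fun v x.
  set s := t * a + (1 - t) * b.
  have Ha := ler_wpM2l t0 (norm_powR_tangent s p1 a).
  have Hb := ler_wpM2l t1' (norm_powR_tangent s p1 b).
  have := lerD Ha Hb; apply: le_trans.
  rewrite -[leLHS]addr0 le_eqVlt; apply/orP; left; apply/eqP.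
  by rewrite /s; ring.
rewrite esumD => [|x _|x _]; rewrite ?lee_fin ?mulr_ge0//.
rewrite !esumZ//.
apply: (@le_trans _ _ (t%:E * B%:E + (1 - t)%:E * B%:E)%E).
  by apply: leeD; apply: lee_wpmul2l; rewrite ?lee_fin.
by rewrite -!EFinM -EFinD lee_fin; lra.
Qed.

Lemma Lp_ball_closed p B : 0 < p -> closed_pred dot (Lp_ball p B).
Proof.
move=> p0 u z uB uz; apply: (@esum_fatou _ _ (fun n x =>
  `|l2_fun (u n) x| `^ p * w x)) => // x.
apply: cvgM; last exact: cvg_cst.
have norm_pow t : `|t| `^ p = `|spow p t| by rewrite norm_spow.
rewrite norm_pow; under eq_fun do rewrite norm_pow.
apply: cvg_norm; apply: continuous_cvg; first exact: spow_continuous.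
exact: (l2_eval_cvg w_gt0).
Qed.

Lemma Lp_ball0 p B : 0 < p -> 0 <= B -> Lp_ball p B 0.
Proof.
move=> p0 B0; rewrite /Lp_ball esum1 ?lee_fin// => x _.
by rewrite l2_fun0 normr0 powR0 ?gt_eqF// mul0r.
Qed.

Lemma Lp_ball_avg p B u : 1 < p -> Lp_ball p B u -> Lp_ball p B (P u).
Proof.
move=> p1; apply: le_trans.
rewrite -[leRHS](esum_avg qP w_gt0); last by move=> x; exact: powR_ge0.
by apply: le_esum => x _; rewrite lee_fin ler_wpM2r//; exact: norm_powR_jensen.
Qed.

Lemma Lp_ballP p B u : weighted_summable (fun x => `|l2_fun u x| `^ p) ->
  Lp_ball p B u <-> integ (fun x => `|l2_fun u x| `^ p) <= B.
Proof.
by move=> iu; rewrite /Lp_ball esum_tsum// => x; rewrite mulr_ge0 ?powR_ge0.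
Qed.

Lemma Lp_ball_summable p B u : Lp_ball p B u ->
  weighted_summable (fun x => `|l2_fun u x| `^ p).
Proof.
move=> uB; rewrite /weighted_summable /abs_summable.
under eq_esum do rewrite ger0_norm ?mulr_ge0 ?powR_ge0//.
by apply: le_lt_trans uB _; exact: ltry.
Qed.

(** Jensen's inequality makes the balls of l^p stable under P; they are also
    convex, and closed for the l^2 norm by Fatou's lemma. *)
Lemma Q_Lp p u : 1 < p -> weighted_summable (fun x => `|l2_fun u x| `^ p) ->
  weighted_summable (fun x => `|l2_fun (Q u) x| `^ p) /\
  integ (fun x => `|l2_fun (Q u) x| `^ p) <= integ (fun x =>
    `|l2_fun u x| `^ p).
Proof.
move=> p1 iu; have p0 : 0 < p by rewrite (lt_trans ltr01).
have : Lp_ball p (integ (fun x => `|l2_fun u x| `^ p)) (Q u).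
  apply: (@Q_convex (Lp_ball p _)); [exact: Lp_ball_convex|exact:
    Lp_ball_closed| | |].
  - by apply: Lp_ball0 => //; apply: integ_ge0 => x; exact: powR_ge0.
  - by move=> v; exact: Lp_ball_avg.
  - by apply/(Lp_ballP _ iu).
by move=> uB; have iQ := Lp_ball_summable uB; split=> //; apply/(Lp_ballP _ iQ).
Qed.

Lemma S_Lp p u : 1 < p -> weighted_summable (fun x => `|l2_fun u x| `^ p) ->
  weighted_summable (fun x => `|l2_fun (S u) x| `^ p) /\
  integ (fun x => `|l2_fun (S u) x| `^ p) <=
    kappa `^ p * 2 `^ p * 2 * integ (fun x => `|l2_fun u x| `^ p).
Proof.
move=> p1 iu; have p0 : 0 < p by rewrite (lt_trans ltr01).
have [iQ Qle] := Q_Lp p1 iu.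
have iS := weighted_summableZ (kappa `^ p * 2 `^ p) (weighted_summableD iu iQ).
have Sle x : `|l2_fun (S u) x| `^ p <= kappa `^ p * 2 `^ p *
    (`|l2_fun u x| `^ p + `|l2_fun (Q u) x| `^ p).
  rewrite /S l2_funZ l2_funB normrM (gtr0_norm kappa_gt0) powRM ?(ltW
    kappa_gt0)//.
  by rewrite -mulrA ler_wpM2l ?powR_ge0// powR_normB.
have iSu : weighted_summable (fun x => `|l2_fun (S u) x| `^ p).
  by apply: weighted_summable_le iS => x; rewrite ger0_norm ?powR_ge0.
split=> //; apply: le_trans (le_integ iSu iS Sle) _.
rewrite (integZ _ (weighted_summableD iu iQ)) (integD iu iQ) -[leRHS]mulrA.
rewrite ler_wpM2l ?mulr_ge0 ?powR_ge0//.
by rewrite mulr_natl mulr2n lerD2l.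
Qed.

(** As Q = (P + Q^2) / 2 one has 1 - Q = (1 - P) / 2 + (1 - Q^2) / 2, and the
    second term pairs nonnegatively with the dual function because Q^2 is a
    contraction of l^p. Thus S inherits the coercivity of 1 - P in l^p. *)
Lemma S_pairing_ge p f (bf : has_bound f) (bphi : has_bound (fun x =>
  spow (p - 1) (f x))) :
  1 < p ->
  kappa / 4 * integ (energy f (fun x => spow (p - 1) (f x))) <=
  dot (S (l2_of bf)) (l2_of bphi).
Proof.
move=> p1; have p0 : 0 < p by rewrite (lt_trans ltr01).
have ip : 0 <= p^-1 by rewrite invr_ge0 ltW.
have arith1 (a b : R) : b <= a -> p^-1 * b + (1 - p^-1) * a <= a.
  by move=> /(ler_wpM2l ip); lra.
have arith2 (a b c : R) : c <= a -> a - b <= 2 * a - b - c by move=> ?; lra.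
set u := l2_of bf; set phi := l2_of bphi.
have iu := has_bound_summable (has_bound_powR p0 bf).
have [iQ Qle] := Q_Lp p1 (iu : weighted_summable (fun x => `|l2_fun u x| `^ p)).
have [iQQ QQle] := Q_Lp p1 iQ.
have up : dot u phi = integ (fun x => `|f x| `^ p).
  by congr tsum; apply: funext => x; rewrite /= (spow_mul _ p1).
(* Q^2 contracts the l^p norm, and u and phi are extremal for Young's
   inequality. *)
have QQ : dot (Q (Q u)) phi <= dot u phi.
  rewrite up.
  apply: (@le_trans _ _ (integ (fun x => p^-1 * `|l2_fun (Q (Q u)) x| `^ p +
      (1 - p^-1) * `|f x| `^ p))).
    apply: le_integ.
    - exact: (sqr_summable_prod (l2_sqr_summable (Q (Q u))) (l2_sqr_summable
        phi)).
    - exact: weighted_summableD (weighted_summableZ _ iQQ) (weighted_summableZ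
        _ iu).
    - by move=> x; exact: young_spow.
  rewrite (integD (weighted_summableZ _ iQQ) (weighted_summableZ _ iu)) (integZ
    _ iQQ) (integZ _ iu).
  exact: (arith1 _ _ (le_trans QQle Qle)).
rewrite (integ_energy bf bphi) -/u -/phi /S !dotE {1}Q_fix /diff_l2 !dotE.
rewrite [leRHS](_ : _ = kappa / 2 * (2 * dot u phi - dot (P u) phi - dot (Q (Q
  u)) phi)); last by field.
rewrite [leLHS](_ : _ = kappa / 2 * (dot u phi - dot (P u) phi)); last by field.
rewrite ler_pM2l ?divr_gt0//.
exact: arith2.
Qed.

Lemma S_pairing_le p (eps : R) : 1 < p -> 0 < eps -> exists2 C, 0 < C &
  forall f (bf : has_bound f) (bphi : has_bound (fun x => spow (p - 1) (f x))),
  dot (S (l2_of bf)) (l2_of bphi) <=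
  C * integ (fun x => `|l2_fun (S (l2_of bf)) x| `^ p) +
  eps * integ (fun x => `|f x| `^ p).
Proof.
move=> p1 e0; have p0 : 0 < p by rewrite (lt_trans ltr01).
have p10 : 0 < p - 1 by rewrite subr_gt0.
have [C C0 CP] := young_eps p1 e0; exists C => // f bf bphi.
have iu := has_bound_summable (has_bound_powR p0 bf).
have [iS _] := S_Lp p1 (iu : weighted_summable (fun x =>
  `|l2_fun (l2_of bf) x| `^ p)).
rewrite -(integZ _ iS) -(integZ _ iu) -(integD (weighted_summableZ _ iS)
  (weighted_summableZ _ iu)).
apply: le_integ.
- exact: (sqr_summable_prod (l2_sqr_summable (S (l2_of bf))) (l2_sqr_summable
    (l2_of bphi))).
- exact: weighted_summableD (weighted_summableZ _ iS) (weighted_summableZ _ iu).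
move=> x; apply: le_trans (CP _ _).
by rewrite (le_trans (ler_norm _))// normrM /= norm_spow.
Qed.

(** The square root kills constants, so that f may be replaced by f - m. *)
Lemma S_shift f m (bf : has_bound f) (bg : has_bound (fun x => f x - m)) :
  S (l2_of bg) = S (l2_of bf).
Proof.
have bm : has_bound (fun=> m : R) by exists `|m|.
have -> : l2_of bg = l2_of bf - l2_of bm by apply: l2_ext.
rewrite /S (lin_sub (symmetric_linear dotP Q_sym)).
have := @S_const (l2_of bm) m (fun=> erefl); rewrite /S => Sm.
rewrite -[RHS]subr0 -Sm -scalerBr; congr (_ *: _).
by apply: (dot_ext dotP) => z; rewrite !dotE; ring.
Qed.

Lemma Lp_sqrt_lower p : 1 < p -> 0 < tsum w -> exists2 C, 0 < C &
  forall f s (fs : supported_in f s) (bf : has_bound f),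
    integ (fun x => `|f x - (tsum w)^-1 * integ f| `^ p) <=
    C * integ (fun x => `|l2_fun (S (l2_of bf)) x| `^ p).
Proof.
move=> p1 N0; have p0 : 0 < p by rewrite (lt_trans ltr01).
have p10 : 0 < p - 1 by rewrite subr_gt0.
have [c c0 cP] := signed_power_poincare p1.
have c2 : 0 < kappa / 4 * c / 2 by rewrite !(divr_gt0, mulr_gt0).
have [C C0 CP] := S_pairing_le p1 c2.
have arith (a b : R) : kappa / 4 * (c * a) <= C * b + kappa / 4 * c / 2 * a ->
    a <= C / (kappa / 4 * c / 2) * b.
  by move=> ab; rewrite mulrAC ler_pdivlMr//; lra.
have K0 : 0 < 2 * 2 `^ p :> R by rewrite mulr_gt0// powR_gt0.
exists ((2 * 2 `^ p) * (C / (kappa / 4 * c / 2))).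
  by rewrite mulr_gt0// divr_gt0.
move=> f s fs bf.
have [m mP] := cP f s fs; have bg := has_boundB m bf.
have bphi := has_bound_spow p10 bg.
apply: le_trans (mean_comparison m p1 bf N0) _.
rewrite -[leRHS]mulrA ler_pM2l// -(S_shift bf bg).
have H1 := CP _ bg bphi; have H2 := S_pairing_ge bg bphi p1.
have k4 : 0 <= kappa / 4 by rewrite divr_ge0// ltW.
have H3 := ler_wpM2l k4 mP.
exact: (arith _ _ (le_trans (le_trans H3 H2) H1)).
Qed.

Lemma Lp_sqrt_upper p f c (bf : has_bound f) : 1 < p ->
  integ (fun x => `|l2_fun (S (l2_of bf)) x| `^ p) <=
  kappa `^ p * 2 `^ p * 2 * integ (fun x => `|f x - c| `^ p).
Proof.
move=> p1; have p0 : 0 < p by rewrite (lt_trans ltr01).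
have bg := has_boundB c bf; rewrite -(S_shift bf bg).
by have [_] := S_Lp p1 (has_bound_summable (has_bound_powR p0 bg) :
  weighted_summable (fun x => `|l2_fun (l2_of bg) x| `^ p)).
Qed.

End SquareRoot.
End LpTheory.

(** * The lazy walk of a weighted graph *)

(** Reduces comparisons of norms to comparisons of their p-th powers. *)
Lemma comparable_root (R : realType) (X : Type) (A : X -> Prop) (F H : X ->
  \bar R)
    (p c C : R) : 0 < p -> 0 < c -> 0 < C -> (forall f, (0 <= F f)%E) ->
    (forall f, (0 <= H f)%E) ->
    (forall f, A f -> (c%:E * H f <= F f)%E /\ (F f <= C%:E * H f)%E) ->
  comparable_on A (fun f => (F f `^ p^-1)%E) (fun f => (H f `^ p^-1)%E).
Proof.
move=> p0 c0 C0 F0 H0 FH; have ip : 0 <= p^-1 by rewrite invr_ge0 ltW.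
exists (c `^ p^-1), (C `^ p^-1); split; rewrite ?powR_gt0// => f /FH[le1 le2].
have mono (x y : \bar R) : (0 <= x)%E -> (x <= y)%E ->
  (x `^ p^-1 <= y `^ p^-1)%E.
  move=> x0 xy; apply: gt0_ler_poweR => //; rewrite in_itv/= leey andbT//.
  exact: le_trans xy.
split; rewrite -poweR_EFin -poweRM ?lee_fin ?(ltW c0) ?(ltW C0)//;
  apply: mono => //.
by rewrite mule_ge0// lee_fin ltW.
Qed.

Section GraphKernel.
Context {R : realType} {V : choiceType} (G : weighted_graph R V).
Local Notation nu := (vertex_weight G).
Local Notation mu := (fun x y : V => edge_weight G [set x; y]).
Variable M : R.
Hypotheses (M_gt0 : 0 < M) (deg_le : forall x, deg G x <= M * nu x).

Let nu_gt0 := vertex_weight_gt0 G.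
(* Twice the bound of the weighted degree: the walk then stays put with
   probability at least 1 / 2. *)
Let K : R := 2 * M.
Let K_gt0 : 0 < K. Proof. by rewrite mulr_gt0. Qed.

Definition nbrs (x : V) : seq V :=
  undup (x :: fset_set [set y | edges G [set x; y]]).

(** The lazy walk whose generator is the Laplacian divided by K. The possible
    loop at x enters the degree and the diagonal with opposite signs. *)
Definition walk (x y : V) : R :=
  (x == y)%:R * (1 - deg G x / (K * nu x)) + edge_weight G [set x;
    y] / (K * nu x).

Lemma nbrs_out x y : y \notin nbrs x -> edge_weight G [set x; y] = 0.
Proof.
rewrite mem_undup inE negb_or => /andP[_ yN]; apply: edge_weight_out => xy.
move/negP: yN; apply; rewrite in_fset_set ?inE//.
exact: locally_finite.
Qed.

Lemma mem_nbrs x : x \in nbrs x.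
Proof. by rewrite mem_undup mem_head. Qed.

Lemma fsum_nbrs (x : V) (h : V -> R) : (forall y, edge_weight G [set x;
  y] = 0 -> h y = 0) ->
  \sum_(y \in [set: V]) h y = \sum_(y <- nbrs x) h y.
Proof.
move=> h0; rewrite (fsbigE (nbrs x)) ?undup_uniq// => [|y _ /nbrs_out/h0//].
by apply: eq_bigl => y; rewrite in_setT.
Qed.

Lemma deg_nbrs x : deg G x = \sum_(y <- nbrs x) edge_weight G [set x; y].
Proof. by rewrite /deg (@fsum_nbrs x). Qed.

Lemma sum_diag (x : V) (h : V -> R) : \sum_(y <- nbrs x) (x == y)%:R * h y = h
  x.
Proof.
rewrite (bigD1_seq x)/= ?mem_nbrs ?undup_uniq// eqxx mul1r big1 ?addr0// => y.
by rewrite eq_sym => /negbTE->; rewrite mul0r.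
Qed.

Let Knu_gt0 x : 0 < K * nu x. Proof. by rewrite mulr_gt0. Qed.

Let deg_half x : deg G x / (K * nu x) <= 1 / 2.
Proof.
rewrite ler_pdivrMr// (_ : 1 / 2 * _ = M * nu x) ?deg_le//.
by rewrite /K; field.
Qed.

Lemma edge_weight_ge0 e : 0 <= edge_weight G e.
Proof.
have [/edge_weight_gt0/ltW//|/edge_weight_out->//] := pselect (edges G e).
Qed.

Lemma walk_reversible : reversible_kernel nu walk nbrs.
Proof.
split=> [x|x y yN|x y|x|x y]; first exact: undup_uniq.
- rewrite /walk (nbrs_out yN) mul0r addr0.
  have [xy|_] := eqVneq x y; last by rewrite mul0r.
  by rewrite -xy mem_nbrs in yN.
- rewrite /walk addr_ge0//; last first.
    by rewrite divr_ge0 ?edge_weight_ge0// ltW.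
  by rewrite mulr_ge0// subr_ge0 (le_trans (deg_half x))//; lra.
- rewrite /walk big_split/= (sum_diag x (fun=> _)) -big_distrl/= -deg_nbrs.
  by rewrite subrK.
- rewrite /walk setUC; have [->//|xy] := eqVneq x y.
  rewrite !mul0r !add0r.
  have nx : nu x != 0 by rewrite gt_eqF.
  have ny : nu y != 0 by rewrite gt_eqF.
  have nK : K != 0 by rewrite gt_eqF.
  by field; rewrite nx ny nK.
Qed.

Lemma walk_lazy x : 1 / 2 <= walk x x.
Proof.
rewrite /walk eqxx mulr1n [X in _ <= X + _]mul1r.
have : 0 <= edge_weight G [set x; x] / (K * nu x).
  by rewrite divr_ge0 ?edge_weight_ge0// ltW.
have := deg_half x.
move: (deg G x / _) (edge_weight G _ / _) => a b; lra.
Qed.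

Lemma laplacian_walk f x :
  laplacian G f x = K * (f x - avg walk nbrs f x).
Proof.
have nx : nu x != 0 by rewrite gt_eqF.
have nK : K != 0 by rewrite gt_eqF.
rewrite /laplacian (@fsum_nbrs x); last by move=> y ->; rewrite mul0r.
have -> : avg walk nbrs f x = (1 - deg G x / (K * nu x)) * f x +
    (\sum_(y <- nbrs x) edge_weight G [set x; y] * f y) / (K * nu x).
  rewrite -[in RHS](sum_diag x (fun y => (1 - deg G x / (K * nu x)) * f y)).
  rewrite [X in _ = _ + X]big_distrl/= -big_split/=; apply: eq_bigr => y _.
  by rewrite /walk; ring.
under eq_bigr do rewrite mulrBr.
rewrite sumrB -big_distrl/= -deg_nbrs.
by field; rewrite nx nK.
Qed.

Lemma walk_neighbours x y : x != y -> K * (nu x * walk x y) = edge_weight G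
  [set x; y].
Proof.
move=> xy; rewrite /walk (negbTE xy) mul0r add0r.
have nx : nu x != 0 by rewrite gt_eqF.
have nK : K != 0 by rewrite gt_eqF.
by field; rewrite nx nK.
Qed.

Lemma connected_const (h : V -> R) :
  (forall x y, edges G [set x; y] -> h x = h y) -> forall x y, h x = h y.
Proof.
move=> hE x y; have [s [ps <-]] := graph_connected G x y.
elim: s x ps => [//|z s IH] x /= /andP[/asboolP xz zs].
by rewrite (hE _ _ xz) IH.
Qed.

Local Notation dot := (l2_ip (w := nu)).
Local Notation D := (diff_l2 walk_reversible nu_gt0).
Let dotP := l2_ipP nu_gt0.

(** A function of the kernel has zero energy, so it takes equal values at
    neighbours; the graph is connected. *)
Lemma harmonic_const (u : L2 nu) : D u = 0 -> exists c, forall x,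
  l2_fun u x = c.
Proof.
move=> Du.
have [se E] := energy_l2 walk_reversible nu_gt0 u u.
rewrite Du (form0l dotP) mulr0 in E.
have e0 x : 0 <= energy walk nbrs (l2_fun u) (l2_fun u) x.
  by apply: (avg_ge0 walk_reversible) => y; rewrite -expr2 sqr_ge0.
have nu0 x : 0 <= nu x by rewrite ltW.
have ex0 x : energy walk nbrs (l2_fun u) (l2_fun u) x = 0.
  apply/eqP; rewrite eq_le e0 andbT -(@pmulr_lle0 _ (nu x))// -[leRHS]E.
  apply: (le_tsum_at (f := fun x => energy walk nbrs (l2_fun u) (l2_fun u) x *
    nu x)) => //.
  by move=> y; rewrite mulr_ge0.
have edge_eq x y : edges G [set x; y] -> l2_fun u x = l2_fun u y.
  move=> xy; have [->//|xy'] := eqVneq x y.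
  have yn : y \in nbrs x.
    by apply: contraT => /nbrs_out; have := edge_weight_gt0 xy => + h;
      rewrite h ltxx.
  have wpos : 0 < walk x y.
    by rewrite -(pmulr_rgt0 _ (nu_gt0 x)) -(pmulr_rgt0 _ K_gt0)
      walk_neighbours// edge_weight_gt0.
  have : walk x y * ((l2_fun u y - l2_fun u x) * (l2_fun u y - l2_fun u x)) = 0.
    have q0 z : 0 <= walk x z * ((l2_fun u z - l2_fun u x) * (l2_fun u z -
      l2_fun u x)).
      by rewrite mulr_ge0 ?(kernel_ge0 walk_reversible)// -expr2 sqr_ge0.
    apply/eqP; rewrite eq_le q0 andbT -[leRHS](ex0 x) /energy /avg.
    by rewrite (bigD1_seq y)/= ?undup_uniq// lerDl sumr_ge0.
  move/eqP; rewrite mulf_eq0 gt_eqF//= -expr2 sqrf_eq0 subr_eq0 => /eqP->//.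
have [[x0 _]|V0] := pselect (exists x : V, True); last by exists 0 => x;
  case: V0; exists x.
by exists (l2_fun u x0) => x; exact: connected_const.
Qed.


(** * The Laplacian on square summable functions *)

Local Notation nrm := (nrm dot).

Lemma lpnormV2E f : lpnormV G 2 f =
  ((\esum_(x in [set: V]) (f x ^+ 2 * nu x)%:E) `^ 2^-1)%E.
Proof.
rewrite /lpnormV /lpnorm; congr poweR; apply: eq_esum => x _; congr EFin.
by rewrite mulrC (powR_mulrn 2)// real_normK// num_real.
Qed.

Lemma l2P f : l2 G f <-> sqr_summable nu f.
Proof.
have E : (\esum_(x in [set: V]) `|f x ^+ 2 * nu x|%:E =
          \esum_(x in [set: V]) (f x ^+ 2 * nu x)%:E)%E.
  apply: eq_esum => x _; rewrite ger0_norm// mulr_ge0 ?sqr_ge0//.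
  exact: ltW.
rewrite /l2 lpnormV2E /sqr_summable /abs_summable E; split.
  by apply: lty_poweRy; rewrite invr_eq0.
exact: poweR_lty.
Qed.

Lemma l2_l2_fun (u : L2 nu) : l2 G (l2_fun u).
Proof. exact/l2P/l2_sqr_summable. Qed.

Lemma lpnormV2_nrm (u : L2 nu) : lpnormV G 2 (l2_fun u) = (nrm u)%:E.
Proof.
rewrite lpnormV2E (@esum_tsum _ _ (fun x => l2_fun u x ^+ 2 * nu x)).
- by rewrite -(l2_ip_sqr u) poweR_EFin powR12_sqrt ?(form_ge0 dotP).
- by move=> x; rewrite mulr_ge0 ?sqr_ge0// ltW.
- exact: l2_sqr_summable.
Qed.

(** The value 0 outside l2 is arbitrary. *)
Definition to_l2 (f : V -> R) : L2 nu :=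
  if pselect (sqr_summable nu f) is left sf
  then MkL2 (asboolT sf : (f : V -> R^o) \in l2_pred nu) else 0.

Lemma to_l2K f : l2 G f -> l2_fun (to_l2 f) = f.
Proof. by move=> /l2P sf; rewrite /to_l2; case: pselect. Qed.

Lemma l2_funK (u : L2 nu) : to_l2 (l2_fun u) = u.
Proof. by apply: val_inj; exact/to_l2K/l2_l2_fun. Qed.

Definition l2_lift (T : (V -> R) -> V -> R) (u : L2 nu) : L2 nu :=
  to_l2 (T (l2_fun u)).

Definition l2_unlift (T : L2 nu -> L2 nu) (f : V -> R) : V -> R :=
  l2_fun (T (to_l2 f)).

Lemma l2_bounded_l2 T f : l2_bounded_operator G T -> l2 G f -> l2 G (T f).
Proof.
move=> [_ [C TC]] lf; apply: le_lt_trans (TC f lf) _.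
by rewrite -(to_l2K lf) lpnormV2_nrm -EFinM ltry.
Qed.

Lemma l2_liftE T u : l2_bounded_operator G T ->
  l2_fun (l2_lift T u) = T (l2_fun u).
Proof. by move=> Tb; apply: to_l2K; exact/(l2_bounded_l2 Tb)/l2_l2_fun. Qed.

Lemma l2_lift_bounded T : l2_bounded_operator G T ->
  exists2 L, 0 < L & forall u, nrm (l2_lift T u) <= L * nrm u.
Proof.
move=> Tb; have [_ [C TC]] := Tb; exists (`|C| + 1) => [|u].
  by rewrite ltr_wpDl.
have := TC _ (l2_l2_fun u); rewrite -(l2_liftE u Tb) !lpnormV2_nrm -EFinM
  lee_fin.
move=> /le_trans; apply; rewrite ler_wpM2r ?nrm_ge0//.
by rewrite (le_trans (ler_norm _))// lerDl.
Qed.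

Lemma l2_unlift_bounded T L : linear T -> (forall u, nrm (T u) <= L * nrm u) ->
  l2_bounded_operator G (l2_unlift T).
Proof.
move=> Tl TL; split.
  move=> a f g lf lg; rewrite /l2_unlift.
  have -> : to_l2 (fun x => a * f x + g x) = a *: to_l2 f + to_l2 g.
    apply: l2_ext => x; rewrite l2_funD l2_funZ !to_l2K//.
    by apply/l2P; apply: sqr_summable_linear; exact/l2P.
  by rewrite Tl; apply: funext.
exists L => f lf; rewrite -[in leRHS](to_l2K lf) !lpnormV2_nrm -EFinM lee_fin.
exact: TL.
Qed.

Definition l2_laplacian (u : L2 nu) : L2 nu := K *: D u.

Lemma l2_laplacianE u : l2_fun (l2_laplacian u) = laplacian G (l2_fun u).
Proof. by apply: funext => x; rewrite laplacian_walk. Qed.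

(** A bounded left inverse of the Laplacian minus l is a lower bound for it. *)
Lemma resolvent_lower l : resolvent_set G (laplacian G) l ->
  exists2 c, 0 < c & forall h, c * dot h h <= dot (l2_laplacian h - l *: h)
    (l2_laplacian h - l *: h).
Proof.
move=> [S [Sb SP]]; have [L L0 SL] := l2_lift_bounded Sb.
exists ((L ^+ 2)^-1) => [|h]; first by rewrite invr_gt0 exprn_gt0.
rewrite ler_pdivrMl ?exprn_gt0// -!(sqr_nrm dotP) -exprMn.
rewrite ler_sqr ?nnegrE ?mulr_ge0 ?nrm_ge0 ?(ltW L0)//.
have {1}-> : h = l2_lift S (l2_laplacian h - l *: h); last exact: SL.
have [+ _] := SP _ (l2_l2_fun h); rewrite -l2_laplacianE => Sh.
by apply: val_inj; rewrite /= l2_liftE.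
Qed.

(** Since 0 is not in the essential spectrum it is not an accumulation point of
    the spectrum. *)
Lemma isolated_zero : (0 < ereal_inf [set l%:E | l in essential_spectrum G
  (laplacian G)])%E ->
  exists2 e : R, 0 < e & forall l, 0 < l < e -> resolvent_set G (laplacian G) l.
Proof.
move=> gap; have ess0 : ~ essential_spectrum G (laplacian G) 0.
  move=> e0; move: gap; rewrite ltNge => /negP; apply.
  by apply: ereal_inf_lbound; exists 0.
apply: contrapT => noe; apply: ess0; left => U /nbhs_ballP[e /= e0 eU].
have : ~ forall l, 0 < l < e -> resolvent_set G (laplacian G) l.
  by move=> H; apply: noe; exists e.
move=> /existsNP[l /not_implyP[/andP[l0 le] lS]].
exists l; split=> //; first by rewrite gt_eqF.
by apply: eU; rewrite /ball/= sub0r normrN gtr0_norm.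
Qed.

Let Dsym := diff_l2_sym walk_reversible nu_gt0.
Let D_ge0 := diff_l2_ge0 walk_reversible nu_gt0.
Let D_le1 := diff_l2_le1 walk_reversible nu_gt0 walk_lazy.
Let l2c := l2_complete nu_gt0.

Section SpectralGap.
Hypothesis ess_gap :
  (0 < ereal_inf [set l%:E | l in essential_spectrum G (laplacian G)])%E.

Lemma diff_gap : exists t, [/\ 0 < t, t <= 1 &
  forall f, t * dot (D f) f <= dot (D f) (D f)].
Proof.
have [e e0 eP] := isolated_zero ess_gap.
have d0 : 0 < e / K / 2 by rewrite !divr_gt0.
have gap := spectral_gap dotP Dsym D_ge0 D_le1 d0.
exists (Num.min (2 * (e / K / 2)) 1); split.
- by rewrite lt_min ltr01 andbT mulr_gt0.
- by rewrite ge_min lexx orbT.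
- move=> f; apply: (@le_trans _ _ (2 * (e / K / 2) * dot (D f) f)).
    by rewrite ler_wpM2r ?D_ge0// ge_min lexx.
  apply: gap => l /andP[l0 le].
  have [|c c0 cP] := resolvent_lower (eP (K * l) _).
    rewrite mulr_gt0//= mulrC -ltr_pdivlMr//.
    by move: le; rewrite mulrC divfK.
  exists (c / K ^+ 2) => [|h]; first by rewrite divr_gt0// exprn_gt0.
  rewrite mulrAC ler_pdivrMr ?exprn_gt0//.
  apply: le_trans (cP h) _; rewrite /l2_laplacian -scalerA -scalerBr.
  by rewrite !(formE dotP) le_eqVlt; apply/orP; left; apply/eqP; ring.
Qed.

(** Otherwise the gap would make the Laplacian invertible, so that 0 would not
    be in the spectrum. *)
Lemma kernel_nontrivial : spectrum G (laplacian G) 0 ->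
  exists2 h : L2 nu, h != 0 & D h = 0.
Proof.
move=> spec0; apply: contrapT => noh; apply: spec0.
have Dinj h : D h = 0 -> h = 0.
  by move=> Dh; apply/eqP; apply: contrapT => /negP h0; apply: noh; exists h.
have [t [t0 t1 gap]] := diff_gap.
have surj f := injective_surjective dotP Dsym D_ge0 D_le1 l2c t0 t1 gap f Dinj.
have coer f := injective_coercive dotP Dsym D_ge0 D_le1 l2c t0 t1 gap f Dinj.
set C := _ ^+ 2 in coer.
have /choice[E DE] := surj.
have Dl := symmetric_linear dotP Dsym.
have ED u : E (D u) = u.
  apply/eqP; rewrite -subr_eq0; apply/eqP/Dinj.
  by rewrite (lin_sub Dl) DE subrr.
have El : linear E.
  move=> a u v; apply/eqP; rewrite -subr_eq0; apply/eqP/Dinj.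
  by rewrite (lin_sub Dl) Dl !DE subrr.
have KEl : linear (fun u => K^-1 *: E u).
  by move=> a u v; rewrite El scalerDr !scalerA mulrC.
exists (l2_unlift (fun u => K^-1 *: E u)); split.
  apply: (@l2_unlift_bounded _ (K^-1 * C) KEl) => u.
  rewrite nrmZ// ger0_norm ?invr_ge0 ?(ltW K_gt0)// -mulrA ler_pM2l ?invr_gt0//.
  by rewrite -[in leRHS](DE u).
move=> f lf; rewrite -(to_l2K lf); set u := to_l2 f.
have E1 : (fun x => laplacian G (l2_fun u) x - 0 * l2_fun u x) = l2_fun
  (l2_laplacian u).
  by apply: funext => x; rewrite l2_laplacianE mul0r subr0.
have nK : K != 0 by rewrite gt_eqF.
split.
  rewrite E1 /l2_unlift l2_funK /l2_laplacian (lin_scale El) ED scalerA mulVf//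
    scale1r//.
rewrite /l2_unlift l2_funK -l2_laplacianE /l2_laplacian.
apply: funext => x; rewrite mul0r subr0.
by rewrite (lin_scale Dl) scalerA mulfV// scale1r DE.
Qed.

Lemma kernel_const_neq0 : spectrum G (laplacian G) 0 ->
  exists (h : L2 nu) c, c != 0 /\ forall x, l2_fun h x = c.
Proof.
move=> /kernel_nontrivial[h h0 /harmonic_const[c hc]]; exists h, c; split=> //.
apply: contraNneq h0 => c0; apply/eqP/l2_ext => x.
by rewrite hc c0.
Qed.

(** The kernel contains a nonzero constant, which is square summable. *)
Lemma finite_volume : spectrum G (laplacian G) 0 -> abs_summable nu.
Proof.
move=> /kernel_const_neq0[h [c [c0 hc]]].
have := abs_summableZ ((c ^+ 2)^-1) (l2_sqr_summable h).
congr (is_true (abs_summable _)); apply: funext => x.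
by rewrite hc mulKf// sqrf_eq0.
Qed.

Lemma volume_gt0 : spectrum G (laplacian G) 0 -> 0 < tsum nu.
Proof.
move=> spec0; have fin := finite_volume spec0.
have [h h0 _] := kernel_nontrivial spec0.
have [[x _]|V0] := pselect (exists x : V, True).
  apply: lt_le_trans (nu_gt0 x) _; apply: (le_tsum_at x) fin => y.
  exact: ltW.
case/negP: h0; apply/eqP/l2_ext => x; case: V0; by exists x.
Qed.

Lemma poincare_l2 : exists2 C, 0 < C & forall u : L2 nu, exists c,
  tsum (fun x => (l2_fun u x - c) ^+ 2 * nu x) <= C * dot (D u) u.
Proof.
have [t [t0 t1 gap]] := diff_gap.
have proj f := kernel_projection dotP Dsym D_ge0 D_le1 l2c t0 t1 gap f.
set C := (1 - _)^-1 in proj.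
exists (C ^+ 2 + 1) => [|u]; first by rewrite ltr_wpDl ?sqr_ge0.
have [h [Dh hle _]] := proj u.
have [c hc] := harmonic_const Dh; exists c.
have -> : tsum (fun x => (l2_fun u x - c) ^+ 2 * nu x) = nrm (u - h) ^+ 2.
  rewrite (sqr_nrm dotP) l2_ip_sqr; congr tsum; apply: funext => x.
  by rewrite l2_funB hc.
have h0 := nrm_ge0 dot (u - h).
have hle2 : nrm (u - h) ^+ 2 <= (C * Num.sqrt (dot (D u) u)) ^+ 2.
  by rewrite ler_sqr ?nnegrE// (le_trans h0).
apply: le_trans hle2 _; rewrite exprMn sqr_sqrtr ?D_ge0//.
by rewrite ler_wpM2r ?D_ge0// lerDl.
Qed.

End SpectralGap.

(** * The square root of the Laplacian *)

Section LaplacianRoot.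
Local Notation P := (avg_l2 walk_reversible nu_gt0).
Let Psym := avg_l2_sym walk_reversible nu_gt0.

Let P_contract u : nrm (P u) <= nrm u.
Proof. by rewrite ler_wsqrtr// avg_l2_contract. Qed.

Let kappa : R := Num.sqrt K.
Let kappa_gt0 : 0 < kappa. Proof. by rewrite sqrtr_gt0. Qed.

(** Existence and uniqueness of the nonnegative square root, in the form
    sqrt K (1 - Q) where Q is the limit of the iteration. *)
Lemma laplacian_root : exists Q : L2 nu -> L2 nu,
  [/\ symmetric_op dot Q,
      forall u, Q u = 2^-1 *: (P u + Q (Q u)),
      forall (X : L2 nu -> Prop) u, convex_pred X -> closed_pred dot X -> X 0 ->
        (forall v, X v -> X (P v)) -> X u -> X (Q u) &
      forall f, l2 G f -> laplacian_sqrt G f = l2_fun (kappa *: (to_l2 f - Q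
        (to_l2 f)))].
Proof.
have [Q [Qcvg Qfix Qsym Qle]] := sqrt_iteration_limit dotP l2c Psym P_contract.
exists Q; split=> //.
  by move=> X u Xc Xcl X0 XP Xu; exact: (limit_convex dotP Psym Qcvg).
pose S u := kappa *: (u - Q u).
have Ql := symmetric_linear dotP Qsym.
have Pl := symmetric_linear dotP Psym.
have Ssym : symmetric_op dot S.
  by move=> u v; rewrite /S !(formE dotP) Qsym.
have Sl := symmetric_linear dotP Ssym.
have Sle u : nrm (S u) <= kappa * 2 * nrm u.
  rewrite /S nrmZ// gtr0_norm// -mulrA ler_pM2l// mulr_natl mulr2n.
  by rewrite (le_trans (nrmB dotP _ _))// lerD2l.
have S0 u : 0 <= dot (S u) u.
  rewrite /S !(formE dotP) mulr_ge0 ?(ltW kappa_gt0)// subr_ge0.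
  rewrite (le_trans (ler_norm _))// (le_trans (dot_le_nrm dotP _ _))//.
  by rewrite -(sqr_nrm dotP) expr2 ler_wpM2r ?nrm_ge0.
have kk : kappa * kappa = K by rewrite -expr2 sqr_sqrtr// ltW.
have SS u : S (S u) = l2_laplacian u.
  rewrite /S (lin_scale Ql) (lin_sub Ql) -scalerBr scalerA kk /l2_laplacian;
    congr (_ *: _).
  have QQ : Q (Q u) = 2 *: Q u - P u.
    by rewrite [in RHS]Qfix scalerA mulfV// scale1r addrC addKr.
  by rewrite QQ /diff_l2; apply: (dot_ext dotP) => z; rewrite !(formE dotP);
    ring.
have exS : is_nonneg_sqrt G (laplacian G) (l2_unlift S).
  split.
  - exact: l2_unlift_bounded Sl Sle.
  - move=> f g lf lg; rewrite -(to_l2K lf) -(to_l2K lg) /l2_unlift !l2_funK.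
    exact: Ssym.
  - move=> f lf; rewrite -[X in l2dot _ _ X](to_l2K lf) /l2_unlift; exact: S0.
  - by move=> f lf; rewrite /l2_unlift l2_funK SS l2_laplacianE to_l2K.
have [Tb Tsym T0 TT] : is_nonneg_sqrt G (laplacian G) (laplacian_sqrt G).
  by apply: (@getPex _ [set S | is_nonneg_sqrt G (laplacian G) S]);
    exists (l2_unlift S).
pose T := l2_lift (laplacian_sqrt G).
have TE u : l2_fun (T u) = laplacian_sqrt G (l2_fun u) by exact: l2_liftE.
have TsymL : symmetric_op dot T.
  move=> u v; have := Tsym _ _ (l2_l2_fun u) (l2_l2_fun v).
  by rewrite -!TE.
have [L L0 TL] := l2_lift_bounded Tb.
have T0L u : 0 <= dot (T u) u by have := T0 _ (l2_l2_fun u); rewrite -TE.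
have TTL u : T (T u) = l2_laplacian u.
  have TTE : l2_fun (T (T u)) = l2_fun (l2_laplacian u).
    by rewrite l2_laplacianE 2!TE TT//; exact: l2_l2_fun.
  by apply: l2_ext => x; rewrite TTE.
have Tl := symmetric_linear dotP TsymL.
have avg_laplacianE u : P u = u - K^-1 *: l2_laplacian u.
  rewrite /l2_laplacian scalerA mulVf ?gt_eqF// scale1r /diff_l2 opprB addrC
    subrK//.
have TP u : T (P u) = P (T u).
  by rewrite !avg_laplacianE (lin_sub Tl) (lin_scale Tl) -!TTL.
(* T commutes with the Laplacian T^2, hence with P and with the limit Q. *)
have TQ := limit_commute dotP Qcvg Tl TL TP.
have bnd (A : L2 nu -> L2 nu) a : (forall u, nrm (A u) <= a * nrm u) ->
    (forall u, 0 <= dot (A u) u) -> forall u, 0 <= dot (A u) u <= a * dot u u.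
  move=> Aa A0 u; rewrite A0/= (le_trans (ler_norm _))//.
  rewrite (le_trans (dot_le_nrm dotP _ _))// -(sqr_nrm dotP) expr2 mulrA.
  by rewrite ler_wpM2r ?nrm_ge0.
have TS : forall u, T u = S u.
  apply: (@sqrt_unique _ _ _ dotP T S L (kappa * 2)) => //.
  - exact: ltW.
  - by rewrite mulr_ge0// ltW.
  - exact: bnd.
  - exact: bnd.
  - by move=> u; rewrite SS TTL.
  - by move=> u; rewrite /S (lin_scale Tl) (lin_sub Tl) TQ.
by move=> f lf; rewrite -/(S _) -TS TE to_l2K.
Qed.

(** If P u = u then |u - Q u|^2 = <(1 - P) u, u> = 0. *)
Lemma root_const (Q : L2 nu -> L2 nu) u c : symmetric_op dot Q ->
  (forall u, Q u = 2^-1 *: (P u + Q (Q u))) -> (forall x, l2_fun u x = c) ->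
  kappa *: (u - Q u) = 0.
Proof.
move=> Qsym Qfix uc; have Ql := symmetric_linear dotP Qsym.
have Pu : P u = u.
  apply: l2_ext => x; rewrite /= -[RHS]/(l2_fun u x) uc -[RHS](avg_cst
    walk_reversible c x).
  by congr avg; exact: funext.
suff -> : u - Q u = 0 by rewrite scaler0.
apply: (inner_eq0 dotP).
have QQ : Q (Q u) = 2 *: Q u - u.
  by rewrite [in RHS]Qfix Pu scalerA mulfV// scale1r addrC addKr.
have -> : dot (u - Q u) (u - Q u) = dot (u - Q u - Q (u - Q u)) u.
  by rewrite !(formE dotP) (lin_sub Ql) !(formE dotP) !Qsym; ring.
rewrite (lin_sub Ql) QQ !(formE dotP); ring.
Qed.

End LaplacianRoot.

(** * Sums over edges *)

Section EdgeSums.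
Variable p : R.
Hypothesis p_gt0 : 0 < p.

Definition edge_sum (f : V -> R) :=
  (\esum_(e in edges G) (edge_weight G e * `|abs_grad f e| `^ p)%:E)%E.

Let pair_term (f : V -> R) (z : V * V) : \bar R :=
  (edge_weight G [set z.1; z.2] * `|f z.2 - f z.1| `^ p)%:E.

Let pair_term_ge0 f z : (0 <= pair_term f z)%E.
Proof. by rewrite lee_fin mulr_ge0 ?edge_weight_ge0 ?powR_ge0. Qed.

Lemma esum_pair_term f :
  (\esum_(z in [set: V * V]) pair_term f z)%E =
  (K%:E * \esum_(x in [set: V]) (grad_pow walk nbrs p f x * nu x)%:E)%E.
Proof.
have nu0 x : 0 <= nu x by exact: ltW.
rewrite -esumZ ?(ltW K_gt0)//; last first.
  move=> x; rewrite mulr_ge0//; apply: (avg_ge0 walk_reversible) => y.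
  exact: powR_ge0.
rewrite (_ : [set: V * V] = [set: V] `*`` fun=> [set: V]);
  last by apply/seteqP; split.
rewrite (_ : pair_term f = fun z => pair_term f (z.1, z.2));
  last by apply: funext => -[].
rewrite -(@esum_esum _ _ _ [set: V] (fun=> [set: V]) (fun x y =>
  pair_term f (x, y)))//.
apply: eq_esum => x _; rewrite (esum_seq (kernel_uniq walk_reversible x))//;
  last first.
  by move=> y /nbrs_out; rewrite /pair_term/= => ->; rewrite mul0r.
rewrite sumEFin; congr EFin; rewrite /grad_pow /avg big_distrl big_distrr/=.
apply: eq_bigr => y _; have [->|xy] := eqVneq x y.
  by rewrite subrr normr0 powR0 ?gt_eqF// !(mulr0, mul0r).
by rewrite -(walk_neighbours xy); ring.
Qed.

Lemma edge_sum_bounds f :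
  (edge_sum f <= \esum_(z in [set: V * V]) pair_term f z)%E /\
  (\esum_(z in [set: V * V]) pair_term f z <= 2%:E * edge_sum f)%E.
Proof.
have edge_sum0 : (0 <= edge_sum f)%E.
  by apply: esum_ge0 => e _; rewrite lee_fin mulr_ge0 ?edge_weight_ge0
    ?powR_ge0.
have [[x0 _]|V0] := pselect (exists x : V, True); last first.
  split.
    rewrite /edge_sum esum1; first by apply: esum_ge0 => z _;
      exact: pair_term_ge0.
    by move=> e /edgesP[x _]; exfalso; apply: V0; exists x.
  rewrite esum1; first by rewrite mule_ge0.
  by move=> [x y] _; exfalso; apply: V0; exists x.
have /choice[orient orientP] e : exists z : V * V, edges G e -> e = [set z.1;
  z.2].
  have [ee|ne] := pselect (edges G e); last by exists (x0, x0).
  by have [x [y exy]] := edgesP ee; exists (x, y).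
(* Choosing an orientation of each edge covers the ordered pairs of
   neighbours by two copies of the edge set. *)
pose swap (z : V * V) := (z.2, z.1).
have orient_inj : set_inj (edges G) orient.
  by move=> e e'; rewrite !inE => ee ee' oe; rewrite (orientP _ ee) oe -orientP.
have swap_orient_inj : set_inj (edges G) (swap \o orient).
  by move=> e e' ee ee' [e2 e1]; apply: orient_inj => //;
    rewrite (surjective_pairing (orient e)) e1 e2 -surjective_pairing.
have orientE e : edges G e -> pair_term f (orient e) = (edge_weight G e *
  `|abs_grad f e| `^ p)%:E.
  move=> ee; have -> : abs_grad f e = `|f (orient e).2 - f (orient e).1|.
    by rewrite [in LHS](orientP _ ee) abs_gradE distrC.
  by rewrite /pair_term -(orientP _ ee) normr_id.
have swap_orientE e : edges G e -> pair_term f (swap (orient e)) = (edge_weight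
  G e * `|abs_grad f e| `^ p)%:E.
  by move=> ee; rewrite -orientE// /pair_term /swap/= setUC distrC.
have A1 : (\esum_(z in orient @` edges G) pair_term f z)%E = edge_sum f.
  by rewrite esum_image//; apply: eq_esum => e /orientE.
have A2 : (\esum_(z in (swap \o orient) @` edges G) pair_term f z)%E = edge_sum
  f.
  by rewrite esum_image//; apply: eq_esum => e /swap_orientE.
split.
  rewrite -A1 esum_mkcond; apply: le_esum => z _.
  by case: ifP => // _; exact: pair_term_ge0.
have -> : (2%:E * edge_sum f = edge_sum f + edge_sum f)%E.
  by rewrite (_ : 2 = 1 + 1)// EFinD ge0_muleDl// mul1e.
rewrite -{1}A1 -A2 (esum_mkcond (orient @` _)) (esum_mkcond ((swap \o orient)
  @` _)).
rewrite -esumD => [|z _|z _]; try by case: ifP => // _; exact: pair_term_ge0.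
apply: le_esum => z _.
have [ez|nez] := pselect (edges G [set z.1; z.2]); last first.
  rewrite {1}/pair_term edge_weight_out// mul0r adde_ge0//; case: ifP => // _;
    exact: pair_term_ge0.
have [zo|zo] : z = orient [set z.1; z.2] \/ z = swap (orient [set z.1; z.2]).
  have := orientP _ ez; case: (orient [set z.1; z.2]) => a b /=;
    case: (z) => x y /= xy.
  have : [set a; b] x by rewrite -xy; left.
  have : [set a; b] y by rewrite -xy; right.
  have : [set x; y] a by rewrite xy; left.
  have : [set x; y] b by rewrite xy; right.
  move=> [] /= -> [] /= -> [] /= e1 [] /= e2; subst; by [left|right].
- rewrite ifT; last by rewrite inE; exists [set z.1; z.2].
  by rewrite leeDl//; case: ifP => // _; exact: pair_term_ge0.
- rewrite [X in (_ <= _ + X)%E]ifT; last by rewrite inE; exists [set z.1; z.2].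
  by rewrite leeDr//; case: ifP => // _; exact: pair_term_ge0.
Qed.

Lemma edge_sum_grad_pow f :
  let I := (\esum_(x in [set: V]) (grad_pow walk nbrs p f x * nu x)%:E)%E in
  (edge_sum f <= K%:E * I)%E /\ (K%:E * I <= 2%:E * edge_sum f)%E.
Proof. by rewrite /= -esum_pair_term; exact: edge_sum_bounds. Qed.

End EdgeSums.

(** * Equivalence of the norms *)

Section Norms.
Hypothesis ess_gap :
  (0 < ereal_inf [set l%:E | l in essential_spectrum G (laplacian G)])%E.
Hypothesis spec0 : spectrum G (laplacian G) 0.

Let nu_fin := finite_volume ess_gap spec0.
Let N_gt0 := volume_gt0 ess_gap spec0.

Lemma nu_totalE : nu_total G = (tsum nu)%:E.
Proof. by rewrite /nu_total esum_tsum// => x; exact: ltW. Qed.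

Lemma finitely_supportedP (f : V -> R) : finitely_supported f ->
  exists s, supported_in f s.
Proof.
move=> ff; exists (fset_set [set x | f x != 0]); split; first exact: fset_uniq.
move=> x; rewrite in_fset_set// => /negP; rewrite inE/= => /negP; rewrite negbK.
by move/eqP.
Qed.

Lemma meanE (f : V -> R) s : supported_in f s ->
  mean G f = (tsum nu)^-1 * integ nu f.
Proof.
move=> [us fs]; rewrite /mean nu_totalE/=; congr (_ * _).
rewrite /integ (tsum_seq us) => [|x /fs->]; last by rewrite mul0r.
rewrite (fsbigE s)//; first by apply: eq_bigl => x; rewrite in_setT.
by move=> x _ /fs->; rewrite mul0r.
Qed.

Lemma lpnormV_integ p (h : V -> R) : weighted_summable nu (fun x =>
  `|h x| `^ p) ->
  (\esum_(x in [set: V]) (nu x * `|h x| `^ p)%:E)%E =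
  (integ nu (fun x => `|h x| `^ p))%:E.
Proof.
move=> ih; rewrite -[in RHS](esum_tsum _ ih).
  by apply: eq_esum => x _; rewrite mulrC.
by move=> x; rewrite mulr_ge0 ?powR_ge0// ltW.
Qed.

Lemma Lp_equivalences p : 1 < p ->
  comparable_on finitely_supported
    (fun f => lpnormE G p (abs_grad f))
    (fun f => lpnormV G p (fun x => f x - mean G f)) /\
  comparable_on finitely_supported
    (fun f => lpnormV G p (fun x => f x - mean G f))
    (fun f => lpnormV G p (laplacian_sqrt G f)).
Proof.
move=> p1; have p0 : 0 < p by rewrite (lt_trans ltr01).
pose A f := (\esum_(x in [set: V]) (nu x * `|f x - mean G f| `^ p)%:E)%E.
pose B f := (\esum_(x in [set: V]) (nu x * `|laplacian_sqrt G f x| `^ p)%:E)%E.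
have A0 f : (0 <= A f)%E.
  by apply: esum_ge0 => x _; rewrite lee_fin mulr_ge0 ?powR_ge0// ltW.
have B0 f : (0 <= B f)%E.
  by apply: esum_ge0 => x _; rewrite lee_fin mulr_ge0 ?powR_ge0// ltW.
have E0 f : (0 <= edge_sum p f)%E.
  by apply: esum_ge0 => e _; rewrite lee_fin mulr_ge0 ?edge_weight_ge0
    ?powR_ge0.
have AE f s : supported_in f s -> A f =
    (integ nu (fun x => `|f x - (tsum nu)^-1 * integ nu f| `^ p))%:E.
  move=> fs; rewrite /A (meanE fs) lpnormV_integ//.
  exact/(has_bound_summable nu_fin)/(has_bound_powR
    p0)/has_boundB/(supported_in_bounded fs).
have poin := poincare_l2 ess_gap.
split.
  have [C C0 CP] := Lp_poincare nu_fin poin p1 N_gt0.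
  have K2 : 0 < 2 * 2 `^ p :> R by rewrite mulr_gt0// powR_gt0.
  apply: (@comparable_root _ _ _ (edge_sum p) A p (K / (2 * C)) (K * (2 * 2 `^
    p))) => //.
  - by rewrite divr_gt0// mulr_gt0.
  - by rewrite mulr_gt0.
  move=> f /finitely_supportedP[s fs].
  have bf := supported_in_bounded fs.
  have igp := has_bound_summable nu_fin (has_bound_grad_pow walk_reversible p0
    bf).
  have [] := edge_sum_grad_pow p0 f.
  rewrite (esum_tsum _ igp); last first.
    move=> x; rewrite mulr_ge0 ?(ltW (nu_gt0 x))//.
    by apply: (avg_ge0 walk_reversible) => y; exact: powR_ge0.
  rewrite -[tsum _]/(integ nu (grad_pow walk nbrs p f)) -EFinM (AE _ _ fs) =>
    up low.
  split.
    rewrite -(@lee_pmul2l _ 2%:E)//; apply: le_trans low.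
    rewrite -!EFinM lee_fin -ler_pdivlMl//.
    rewrite mulrAC ler_pdivrMr ?mulr_gt0//.
    have := ler_wpM2l (ltW K_gt0) (CP f s fs).
    by move=> /le_trans; apply; rewrite le_eqVlt; apply/orP; left; apply/eqP;
      field.
  apply: le_trans up _; rewrite -EFinM lee_fin -[leRHS]mulrA ler_pM2l//.
  exact: (integ_grad_pow_le walk_reversible nu_gt0 nu_fin).
have [Q [Qsym Qfix Qconv Qroot]] := laplacian_root.
have kap0 : 0 < Num.sqrt K by rewrite sqrtr_gt0.
have Sc u c (uc : forall x, l2_fun u x = c) := root_const Qsym Qfix uc.
have [C C0 CP] := Lp_sqrt_lower nu_fin poin Qfix Qsym kap0 Qconv Sc p1 N_gt0.
pose C' : R := Num.sqrt K `^ p * 2 `^ p * 2.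
have C'0 : 0 < C' by rewrite !mulr_gt0 ?powR_gt0.
apply: (@comparable_root _ _ _ A B p C'^-1 C) => //; first by rewrite invr_gt0.
move=> f /finitely_supportedP[s fs].
have bf := supported_in_bounded fs.
have lf : l2 G f by exact/l2P/(has_bound_sqr_summable nu_fin).
have rootE : laplacian_sqrt G f =
    l2_fun (Num.sqrt K *: (l2_of nu_fin bf - Q (l2_of nu_fin bf))).
  rewrite (Qroot _ lf); congr (l2_fun (_ *: (_ - Q _))).
    by apply: l2_ext => x; rewrite to_l2K.
  by apply: l2_ext => x; rewrite to_l2K.
have ib := has_bound_summable nu_fin (has_bound_powR p0 bf).
have [iS _] := S_Lp kap0 Qconv p1
  (ib : weighted_summable nu (fun x => `|l2_fun (l2_of nu_fin bf) x| `^ p)).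
have BE : B f = (integ nu (fun x => `|l2_fun (Num.sqrt K *:
    (l2_of nu_fin bf - Q (l2_of nu_fin bf))) x| `^ p))%:E.
  by rewrite /B rootE lpnormV_integ.
rewrite (AE _ _ fs) BE -!EFinM !lee_fin; split; last exact: (CP f s fs bf).
rewrite ler_pdivrMl//; exact: (Lp_sqrt_upper _ Qsym kap0 Qconv Sc _ bf p1).
Qed.

End Norms.
End GraphKernel.

Theorem theorem1p4 (R : realType) (V : choiceType) (G : weighted_graph R V)
    (M_finite : (ereal_sup [set (deg G x / vertex_weight G x)%:E | x in [set: V]]
                 < +oo)%E)
    (ess_gap : (0 < ereal_inf [set l%:E | l in
                      essential_spectrum G (laplacian G)])%E)
    (spec0 : spectrum G (laplacian G) 0) :
  (nu_total G < +oo)%E /\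
  forall p : R, 1 < p ->
    comparable_on finitely_supported
      (fun f => lpnormE G p (abs_grad f))
      (fun f => lpnormV G p (fun x => f x - mean G f)) /\
    comparable_on finitely_supported
      (fun f => lpnormV G p (fun x => f x - mean G f))
      (fun f => lpnormV G p (laplacian_sqrt G f)).
Proof.
have [M M_gt0 deg_le] : exists2 M : R, 0 < M &
    forall x, deg G x <= M * vertex_weight G x.
  set s := ereal_sup _ in M_finite.
  have sup_le x : ((deg G x / vertex_weight G x)%:E <= s)%E.
    by apply: ereal_sup_ubound; exists x.
  exists (`|fine s| + 1) => [|x]; first by rewrite ltr_wpDl.
  rewrite -ler_pdivrMr ?vertex_weight_gt0// -lee_fin.
  apply: le_trans (sup_le x) _; move: sup_le M_finite.
  case: (s) => [r _ _|//|/(_ x)//] /=.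
  by rewrite lee_fin (le_trans (ler_norm _))// lerDl.
split; first by rewrite (nu_totalE M_gt0 deg_le ess_gap spec0) ltry.
by move=> p p1; exact: (Lp_equivalences M_gt0 deg_le ess_gap spec0).
Qed.
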